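(* Let $\lambda\in(\frac12,1)$ and let $\nu_\lambda$ be the Bernoulli convolution (the distribution of $\sum_{n\ge0}\pm\lambda^n$ with independent, equally likely signs). Then $$HD(\nu_\lambda)\le\frac{\log\frac{2}{o(\mathcal S_\lambda)}}{|\log\lambda|},$$ where the overlap number $o(\mathcal S_\lambda)$ satisfies $$o(\mathcal S_\lambda)=\exp\Big(\lim_{n\to\infty}\frac1n\int_{\Sigma_2^+}\log\beta_n(\pi_\lambda\omega)\,d\nu_{(\frac12,\frac12)}(\omega)\Big).$$ Consequently $o(\mathcal S_\lambda)\le2\lambda^{HD(\nu_\lambda)}$.
   Context: $\mathcal S_\lambda=\{S_1,S_2\}$ with $S_1(x)=\lambda x-1$, $S_2(x)=\lambda x+1$; its limit set is $I_\lambda=[-\frac1{1-\lambda},\frac1{1-\lambda}]$, $\Sigma_2^+=\{1,2\}^{\mathbb N}$ with shift $\sigma$, $\pi_\lambda(\omega)=\lim_n S_{\omega_1}\circ\cdots\circ S_{\omega_n}(0)$ is the coding map, and $\nu_\lambda=(\pi_\lambda)_*\nu_{(\frac12,\frac12)}$ with $\nu_{(\frac12,\frac12)}$ the uniform Bernoulli measure. $\beta_n(x)$ is the number of $(\zeta_1,\dots,\zeta_n)\in\{1,2\}^n$ with $x\in S_{\zeta_1}\circ\cdots\circ S_{\zeta_n}(I_\lambda)$. The overlap number $o(\mathcal S_\lambda)$ is defined as $\exp(\lim_n\frac1n\int\log b_n(\omega,x)\,d\hat\mu_0(\omega,x))$, where $\hat\mu_0$ is the measure of maximal entropy of the lift map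 $\Phi_\lambda(\omega,x)=(\sigma\omega,S_{\omega_1}(x))$ on $\Sigma_2^+\times I_\lambda$ and $b_n(\omega,x)$ is the number of $(\eta_1,\dots,\eta_n)\in\{1,2\}^n$ with $S_{\omega_n}\circ\cdots\circ S_{\omega_1}(x)\in S_{\eta_n}\circ\cdots\circ S_{\eta_1}(I_\lambda)$. $HD(\mu)=\inf\{HD(Z):\mu(\text{complement of }Z)=0\}$. *)

(* Defs.v *)
From HB Require Import structures.
From mathcomp Require Import all_boot all_order all_algebra.
From mathcomp Require Import all_classical all_reals all_analysis.
Import Order.TTheory GRing.Theory Num.Theory numFieldNormedType.Exports.

Set Implicit Arguments.
Unset Strict Implicit.
Unset Printing Implicit Defensive.

Local Open Scope classical_set_scope.
Local Open Scope ring_scope.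

(* The IFS S_lambda = {S_1, S_2}.  Symbols: false <-> 1, true <-> 2.  *)

Definition Smap {R : realType} (lam : R) (b : bool) (x : R) : R :=
  lam * x + (if b then 1 else -1).

(* limit set I_lambda = [-1/(1-lam), 1/(1-lam)] *)
Definition Ilam {R : realType} (lam : R) : set R :=
  `[- (1 - lam)^-1, (1 - lam)^-1]%classic.

Definition compS {R : realType} (lam : R) (s : seq bool) (x : R) : R :=
  foldr (Smap lam) x s.

Definition compS_rev {R : realType} (lam : R) (s : seq bool) (x : R) : R :=
  foldl (fun y b => Smap lam b y) x s.

(* Symbolic space Sigma_2^+ = {1,2}^N (indexed from 0: w 0 = omega_1) *)

Definition cyl (n : nat) (u : nat -> bool) : set (nat -> bool) :=
  [set w | forall i, (i < n)%N -> w i = u i].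

Definition cylinders : set (set (nat -> bool)) :=
  [set C | exists n u, C = cyl n u].

Definition Sigma2 := g_sigma_algebraType cylinders.

Definition shift (w : Sigma2) : Sigma2 := fun n => w n.+1.

Definition prefix (w : Sigma2) (n : nat) : seq bool := mkseq w n.

Definition coding {R : realType} (lam : R) (w : Sigma2) : R :=
  lim ((fun n => compS lam (prefix w n) 0) @ \oo).

(* nu_(1/2,1/2): the uniform Bernoulli measure, characterized by its values
   on cylinders (this determines it uniquely on the generated sigma-algebra) *)
Definition is_uniform_bernoulli {R : realType} (P : probability Sigma2 R) :=
  forall (n : nat) (u : nat -> bool), P (cyl n u) = ((2 : R) ^- n)%:E.

Definition bernoulli_conv {R : realType} (lam : R) (P : probability Sigma2 R)
  : set R -> \bar R := pushforward P (coding lam).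

Definition beta_n {R : realType} (lam : R) (n : nat) (x : R) : nat :=
  #|[set z : n.-tuple bool | `[< (compS lam z @` Ilam lam) x >]]|.

(* Lift map Phi_lambda on Sigma_2^+ x R (invariant measures considered *)
(* are those carried by Sigma_2^+ x I_lambda).                         *)

Definition Phi {R : realType} (lam : R) (p : Sigma2 * R) : Sigma2 * R :=
  (shift p.1, Smap lam (p.1 0%N) p.2).

Definition b_n {R : realType} (lam : R) (n : nat) (p : Sigma2 * R) : nat :=
  #|[set e : n.-tuple bool |
      `[< (compS_rev lam e @` Ilam lam) (compS_rev lam (prefix p.1 n) p.2) >]]|.

Section Entropy.
Context {d : measure_display} {T : measurableType d} {R : realType}.

Definition is_fin_partition (k : nat) (A : 'I_k -> set T) :=
  [/\ forall i, measurable (A i),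
      forall i j, i != j -> A i `&` A j = set0 &
      forall x, exists i, A i x].

Definition join_cell (f : T -> T) (k n : nat) (A : 'I_k -> set T)
  (t : n.-tuple 'I_k) : set T :=
  [set x | forall i : 'I_n, A (tnth t i) (iter i f x)].

(* H_mu( v_{i<n} f^{-i} xi ),  with 0 log 0 = 0 *)
Definition join_entropy (mu : set T -> \bar R) (f : T -> T) (k : nat)
  (A : 'I_k -> set T) (n : nat) : R :=
  \sum_(t : n.-tuple 'I_k)
     (- (fine (mu (join_cell f A t)) * ln (fine (mu (join_cell f A t))))).

Definition part_entropy (mu : set T -> \bar R) (f : T -> T) (k : nat)
  (A : 'I_k -> set T) : R :=
  lim ((fun n => (n%:R)^-1 * join_entropy mu f A n) @ \oo).

Definition ks_entropy (mu : set T -> \bar R) (f : T -> T) : \bar R :=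
  ereal_sup [set e | exists k (A : 'I_k -> set T),
                       is_fin_partition A /\ e = (part_entropy mu f A)%:E].

Definition invariant (mu : set T -> \bar R) (f : T -> T) :=
  forall A, measurable A -> mu (f @^-1` A) = mu A.

End Entropy.

Definition is_mme {R : realType} (lam : R) (mu : probability (Sigma2 * R)%type R) :=
  [/\ invariant mu (Phi lam),
      mu (setT `*` Ilam lam) = 1%E &
      forall nu : probability (Sigma2 * R)%type R,
        invariant nu (Phi lam) -> nu (setT `*` Ilam lam) = 1%E ->
        (ks_entropy nu (Phi lam) <= ks_entropy mu (Phi lam))%E].

Definition overlap {R : realType} (lam : R) (mu : probability (Sigma2 * R)%type R) : R :=
  expR (lim ((fun n : nat => (n%:R)^-1 *
                Rintegral mu setT (fun p => ln ((b_n lam n p)%:R : R))) @ \oo)).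

Definition diamE {R : realType} (U : set R) : \bar R :=
  ereal_sup [set e | exists x y, U x /\ U y /\ e = (`|x - y|)%:E].

Definition hcost {R : realType} (s : R) (U : set R) : \bar R :=
  if `[< U = set0 >] then 0%E else ((fine (diamE U)) `^ s)%:E.

Definition hausdorff_delta {R : realType} (s delta : R) (Z : set R) : \bar R :=
  ereal_inf [set e | exists U : nat -> set R,
     [/\ Z `<=` \bigcup_i U i, forall i, (diamE (U i) <= delta%:E)%E &
         e = (\sum_(0 <= i <oo) hcost s (U i))%E]].

Definition hausdorff_measure {R : realType} (s : R) (Z : set R) : \bar R :=
  ereal_sup [set e | exists2 delta, 0 < delta & e = hausdorff_delta s delta Z].

Definition hdim {R : realType} (Z : set R) : R :=
  inf [set s | 0 <= s /\ hausdorff_measure s Z = 0%E].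

Definition hdim_measure {R : realType} (nu : set R -> \bar R) : R :=
  inf [set h | exists Z : set R, [/\ measurable Z, nu (~` Z) = 0%E & h = hdim Z]].

(* Main.v *)
(** Write [x = S_z(y)] with [z] a word of length [n]: whether another cylinder
    covers [x] depends, up to boundedly many grid cells of size comparable to
    [lam ^ n], only on the cell of [S_z(0)].  Hence the mean of [ln beta_n] is
    within a constant of [gavg n], the mean logarithmic occupation of the cells
    by the points [S_z(0)].  Splitting words and Jensen's inequality make [gavg]
    subadditive up to a constant, so the limit [L] exists by Fekete's argument.

    For the dimension bound, [beta_n >= exp(n (L - e))] holds for infinitely many
    [n] with positive probability, hence almost surely by ergodicity of the shift,
    and the points where it holds for a given [n] are covered by about
    [2 ^ n exp(- n (L - e))] balls of radius comparable to [lam ^ n].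

    A measure of maximal entropy enters only through its second marginal.  The
    base of the lift being the full shift, entropy [ln 2] forces a uniform first
    marginal: otherwise one writes down a code (Gibbs' inequality) for the
    itineraries of any partition with rate below [ln 2], because given the base
    word the fibre coordinate is an increasing function of the initial point and
    contributes only polynomially many itineraries.  Contraction of the fibres and
    invariance then identify the second marginal with the Bernoulli convolution,
    and [b_n(w, x) = beta_n(Phi^n(w, x))] turns one integral into the other. *)

Require Import Defs.
From HB Require Import structures.
From mathcomp Require Import all_boot all_order all_algebra.
From mathcomp Require Import all_classical all_reals all_analysis.
From mathcomp Require Import measurable_realfun.
From mathcomp Require Import ring lra zify.
Import Order.TTheory GRing.Theory Num.Theory numFieldNormedType.Exports.

Set Implicit Arguments.
Unset Strict Implicit.
Unset Printing Implicit Defensive.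

Local Open Scope classical_set_scope.
Local Open Scope ring_scope.

Local Notation prefix := Defs.prefix.
Local Notation shift := Defs.shift.
Local Notation invariant := Defs.invariant.

(** * Counting in cells *)

(** The obstacle in comparing [beta_n] with the occupation of cells is the lower bound. The point
    coded by a word [z] and a tail is shifted from [pt z] by up to one mesh width, so the interval
    of radius one mesh around it is sure to contain only the part of the cell of [z] on one side of
    [pt z]; for a word near the end of its cell this may be almost nothing. No pointwise bound by
    the cell size is available. On average over a cell, however, the product of the one-sided ranks
    is at least a factorial, and Stirling's bound loses only a constant in the mean logarithm.

    On the entropy side the partition is an arbitrary measurable one, whereas only itineraries
    described by finitely many letters and thresholds can be counted. The partition is therefore
    approximated in measure, and the rare disagreements are paid for inside the code. That a measure
    of maximal entropy has entropy at least [ln 2] comes from an explicit competitor, the product of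
    the Bernoulli measure with the Bernoulli convolution. *)

Lemma ln_le_sub1 (R : realType) (x : R) : 0 < x -> ln x <= x - 1.
Proof.
move=> x0; have := expR_ge1Dx (ln x); rewrite lnK ?posrE//; lra.
Qed.

Lemma ln_nat_ge0 (R : realType) (k : nat) : 0 <= ln k%:R :> R.
Proof. by case: k => [|k]; [rewrite ln0|rewrite ln_ge0// ler1n]. Qed.

(** Jensen's inequality for the logarithm, from its tangent line at [C]: summing
    [ln x <= ln C + x / C - 1] needs only a bound on the mean. *)
Lemma ln_sum_le (R : realType) (T : finType) (f : T -> R) (C : R) :
  0 < C -> (forall t, 0 < f t) -> \sum_t f t <= C * #|T|%:R ->
  \sum_t ln (f t) <= #|T|%:R * ln C.
Proof.
move=> C0 f0 fC.
have h t : ln (f t) <= ln C + (f t / C - 1).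
  have := @ln_le_sub1 R (f t / C); rewrite divr_gt0// => /(_ isT).
  by rewrite ln_div ?posrE//; lra.
apply: (le_trans (ler_sum _ (fun t _ => h t))).
rewrite big_split /= sumrB -mulr_suml !sumr_const -[ln C *+ _]mulr_natl.
suff : (\sum_i f i) / C <= #|T|%:R by rewrite -[1 *+ _]/(#|T|%:R); lra.
by rewrite ler_pdivrMr// mulrC.
Qed.

Section Cells.
Variables (R : realType) (T : finType) (c : T -> int) (p : T -> R).

Definition cell_card (t : T) : nat := #|[pred s | c s == c t]|.
Definition rank_up (t : T) : nat := #|[pred s | (c s == c t) && (p t <= p s)]|.
Definition rank_down (t : T) : nat := #|[pred s | (c s == c t) && (p s <= p t)]|.

Lemma cell_card_gt0 t : (0 < cell_card t)%N.
Proof. by apply/card_gt0P; exists t; rewrite inE. Qed.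

Lemma rank_up_gt0 t : (0 < rank_up t)%N.
Proof. by apply/card_gt0P; exists t; rewrite !inE eqxx lexx. Qed.

Lemma rank_down_gt0 t : (0 < rank_down t)%N.
Proof. by apply/card_gt0P; exists t; rewrite !inE eqxx lexx. Qed.

Lemma rank_up_le t : (rank_up t <= cell_card t)%N.
Proof. by apply: subset_leq_card; apply/fintype.subsetP => s; rewrite !inE => /andP[]. Qed.

Lemma rank_down_le t : (rank_down t <= cell_card t)%N.
Proof. by apply: subset_leq_card; apply/fintype.subsetP => s; rewrite !inE => /andP[]. Qed.

Lemma cell_card_eq s t : c s = c t -> cell_card s = cell_card t.
Proof. by rewrite /cell_card => ->. Qed.

(** The weight [1 / cell_card] spreads mass one over each occupied cell, so weighted sums over
    points count cells; the bound is strict when the cell [z] is empty. *)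
Lemma sum_inv_cell (z : int) :
  \sum_(t | c t == z) ((cell_card t)%:R : R)^-1 <= 1.
Proof.
rewrite (eq_bigr (fun _ => (#|[pred s | c s == z]|%:R)^-1)); last first.
  by move=> t /eqP <-.
rewrite sumr_const -[_ *+ _]mulr_natl.
rewrite -[X in X%:R * _]/(#|[pred s | c s == z]|).
case: (#|[pred s | c s == z]|) => [|k]; first by rewrite mul0r ler01.
by rewrite mulfV.
Qed.

Lemma sum_inv_near_cells (K : nat) (z : int) :
  \sum_(t | `|c t - z| <= K%:Z) ((cell_card t)%:R : R)^-1 <= (2 * K + 1)%:R.
Proof.
pose f t : R := ((cell_card t)%:R)^-1.
have f0 t : 0 <= f t by rewrite invr_ge0.
apply: (@le_trans _ _ (\sum_t \sum_(i < 2 * K + 1)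
   (if c t == z + i%:Z - K%:Z then f t else 0))).
  rewrite big_mkcond; apply: ler_sum => t _; case: ifP => [tz|_]; last first.
    by apply: sumr_ge0 => i _; case: ifP.
  have hi : (absz (c t - z + K%:Z)%R < 2 * K + 1)%N by lia.
  rewrite (bigD1 (Ordinal hi)) //= ifT; last by apply/eqP; lia.
  by rewrite lerDl sumr_ge0// => i _; case: ifP.
rewrite exchange_big /= -[leRHS](_ : \sum_(i < 2 * K + 1) 1 = _); last first.
  by rewrite sumr_const card_ord.
by apply: ler_sum => i _; rewrite -big_mkcond /=; apply: sum_inv_cell.
Qed.

(** Each [t] is counted once for every [s] in its cell, with weight [1 / cell_card]. This reduces
    inequalities between sums over all points to single cells without indexing the cells
    themselves. *)
Lemma sum_by_cells (F : T -> R) :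
  \sum_t F t = \sum_s ((cell_card s)%:R)^-1 * \sum_(t | c t == c s) F t.
Proof.
under [RHS]eq_bigr => s _ do rewrite mulr_sumr.
rewrite (exchange_big_dep xpredT) //=; apply: eq_bigr => t _.
under eq_bigr => s /eqP e do rewrite -(cell_card_eq e).
rewrite sumr_const -[_ *+ _]mulr_natl mulrA.
rewrite (_ : #|_| = cell_card t); last first.
  by apply: eq_card => s; rewrite !inE eq_sym.
by rewrite mulfV ?mul1r// pnatr_eq0 -lt0n cell_card_gt0.
Qed.

Lemma ler_sum_by_cells (F F' : T -> R) :
  (forall s, \sum_(t | c t == c s) F t <= \sum_(t | c t == c s) F' t) ->
  \sum_t F t <= \sum_t F' t.
Proof.
move=> h; rewrite sum_by_cells [leRHS]sum_by_cells; apply: ler_sum => s _.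
by rewrite ler_wpM2l// invr_ge0.
Qed.

End Cells.

(** For distinct values the ranks are exactly 1, ..., [#|A|]; ties only enlarge them. Removing a
    minimal element, whose rank is the full cardinal, gives the induction. *)
Lemma fact_le_prod_rank (d : Order.disp_t) (V : orderType d) (T : finType)
    (A : {set T}) (p : T -> V) :
  ((#|A|)`! <= \prod_(t in A) #|[pred s | (s \in A) && (p t <= p s)%O]|)%N.
Proof.
move Hn : #|A| => n; elim: n A Hn => [|n IH] A An.
  by rewrite (cards0_eq An) big_set0.
have /card_gt0P[t0 t0A] : (0 < #|A|)%N by rewrite An.
have [m mA' mle] := @arg_minP _ _ _ t0 (mem A) p t0A; have mA : m \in A := mA'.
rewrite (big_setD1 m) //= factS; apply: leq_mul.
  by rewrite -An; apply: subset_leq_card; apply/fintype.subsetP => s sA; rewrite !inE sA mle.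
apply: (leq_trans (IH (A :\ m)%SET _)).
  by have := cardsD1 m A; rewrite mA An; lia.
apply: leq_prod => t _; apply: subset_leq_card.
by apply/fintype.subsetP => s; rewrite !inE => /andP[/andP[_ ->] ->].
Qed.

(** The weak Stirling bound [n! >= (n / e) ^ n], by induction from [ln (1 + 1 / n) <= 1 / n]. *)
Lemma ln_fact_ge (R : realType) (n : nat) :
  n%:R * ln n%:R - n%:R <= ln (n`!%:R : R).
Proof.
elim: n => [|n IH]; first by rewrite fact0 ln1 mul0r subrr.
rewrite factS natrM lnM ?posrE ?ltr0n ?fact_gt0//.
suff : n%:R * (ln n.+1%:R - ln n%:R) <= 1 :> R.
  rewrite -[n.+1%:R]natr1; nra.
case: n {IH} => [|n]; first by rewrite mul0r ler01.
rewrite -ln_div ?posrE//.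
have := @ln_le_sub1 R (n.+2%:R / n.+1%:R); rewrite divr_gt0// => /(_ isT) h.
apply: (le_trans (ler_wpM2l _ h)) => //.
by rewrite mulrBr mulrCA mulfV// -[n.+2%:R]natr1; lra.
Qed.

Section CellRanks.
Variables (R : realType) (T : finType) (c : T -> int) (p : T -> R).
Local Notation G := (cell_card c).

Lemma ln_prod_seq (I : finType) (P : pred I) (F : I -> R) :
  (forall i, P i -> 0 < F i) ->
  ln (\prod_(i | P i) F i) = \sum_(i | P i) ln (F i).
Proof.
move=> F0.
suff [] : 0 < \prod_(i | P i) F i /\
  ln (\prod_(i | P i) F i) = \sum_(i | P i) ln (F i) by [].
elim/big_rec2: _ => [|i x y Pi [x0 <-]]; first by rewrite ln1.
by rewrite mulr_gt0 ?F0// lnM ?posrE ?F0.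
Qed.

(** In a cell with [m] points the ranks multiply to at least [m!], hence their logarithms lose at
    most [m] against [m ln m]. The order [V] is left general so that the reversed order of the reals
    yields the downward ranks. *)
Lemma sum_ln_rank (d : Order.disp_t) (V : orderType d) (q : T -> V) (r : T -> nat) :
  (forall t, r t = #|[pred s | (c s == c t) && (q t <= q s)%O]|) ->
  \sum_t (ln (G t)%:R - 1) <= \sum_t ln (r t)%:R :> R.
Proof.
move=> rE; apply: (ler_sum_by_cells (c := c)) => s.
pose A := [set t | c t == c s]%SET.
have GA : G s = #|A| by apply: eq_card => t; rewrite !inE.
have := fact_le_prod_rank A q; rewrite -(ler_nat R) natr_prod => h.
have rA t : c t == c s -> r t = #|[pred s | (s \in A) && (q t <= q s)%O]|.
  by move=> /eqP e; rewrite rE; apply: eq_card => u; rewrite !inE e.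
rewrite (eq_bigr (fun _ => ln (#|A|)%:R - 1)); last first.
  by move=> t /eqP /(cell_card_eq) ->; rewrite GA.
rewrite sumr_const -[_ *+ _]mulr_natl -[X in X%:R * _]/(G s) GA mulrBr mulr1.
apply: (le_trans (ln_fact_ge R #|A|)).
rewrite (eq_bigl (mem A)) => [|t]; last by rewrite /= inE.
rewrite (eq_bigr (fun t => ln (#|[pred s | (s \in A) && (q t <= q s)%O]|%:R : R)));
  last by move=> t; rewrite /= inE => ct; rewrite (rA _ ct).
rewrite -ln_prod_seq => [|t tA]; last first.
  by rewrite ltr0n; apply/card_gt0P; exists t; rewrite inE lexx andbT.
by rewrite ler_ln ?posrE ?ltr0n ?fact_gt0// (lt_le_trans _ h)// ltr0n fact_gt0.
Qed.

(* The two ranks in a cell satisfy [min >= up * down / card]. *)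
Lemma sum_ln_min_rank :
  \sum_t (ln (G t)%:R - 2) <= \sum_t ln (minn (rank_up c p t) (rank_down c p t))%:R :> R.
Proof.
have hup := @sum_ln_rank _ _ p (rank_up c p) (fun t => erefl).
have hdn := @sum_ln_rank _ (R^d)%type p (rank_down c p) (fun t => erefl).
apply: (@le_trans _ _ (\sum_t (ln (rank_up c p t)%:R + ln (rank_down c p t)%:R
                               - ln (G t)%:R))).
  move: (lerD hup hdn); rewrite -big_split /= -big_split /= => h.
  rewrite -subr_ge0 -sumrB; rewrite -subr_ge0 -sumrB in h.
  by apply: (le_trans h); rewrite le_eqVlt; apply/orP; left; apply/eqP/eq_bigr => t _; ring.
apply: ler_sum => t _.
have u0 : 0 < (rank_up c p t)%:R :> R by rewrite ltr0n rank_up_gt0.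
have d0 : 0 < (rank_down c p t)%:R :> R by rewrite ltr0n rank_down_gt0.
have ug : ln (rank_up c p t)%:R <= ln (G t)%:R :> R.
  by rewrite ler_ln ?posrE ?ltr0n ?rank_up_gt0 ?cell_card_gt0// ler_nat rank_up_le.
have dg : ln (rank_down c p t)%:R <= ln (G t)%:R :> R.
  by rewrite ler_ln ?posrE ?ltr0n ?rank_down_gt0 ?cell_card_gt0// ler_nat rank_down_le.
by rewrite /minn; case: ifP => _; lra.
Qed.

End CellRanks.

(** * Words and grid cells *)

(** Fekete's argument for [a + C], which is subadditive; the limit is the infimum of [(a n + C) / n]
    over positive [n]. *)
Lemma quasi_subadditive_cvg (R : realType) (a : nat -> R) (C : R) :
  0 <= C -> (forall n, 0 <= a n) ->
  (forall n m, a (n + m)%N <= a n + a m + C) ->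
  cvg ((fun n => (n%:R)^-1 * a n) @ \oo).
Proof.
move=> C0 a0 aD; pose b n := a n + C.
have bD n m : b (n + m)%N <= b n + b m by rewrite /b; have := aD n m; lra.
have b0 n : 0 <= b n by rewrite /b addr_ge0.
have bM q m : b (q.+1 * m)%N <= q.+1%:R * b m.
  elim: q => [|q IH]; first by rewrite !mul1n mul1r.
  by rewrite mulSn (le_trans (bD _ _))// -(natr1 q.+1) mulrDl mul1r addrC lerD2r.
pose S := [set b n.+1 / n.+1%:R | n in [set: nat]].
have S0 : has_inf S.
  by split; [exists (b 1%N / 1), 0%N|exists 0 => _ [n _ <-]; rewrite divr_ge0].
have Slb n : inf S <= b n.+1 / n.+1%:R by apply: ge_inf; [case: S0|exists n].
apply/cvg_ex; exists (inf S); apply/cvgrPdist_le => e e0.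
have e20 : 0 < e / 2 by rewrite divr_gt0.
have [_ [m _ <-] mlt] := inf_adherent e20 S0.
move: Slb mlt; move: (inf S) => L Slb mlt.
pose B := \sum_(r < m.+1) b r.
have Br r : (r < m.+1)%N -> b r <= B.
  move=> rm; rewrite /B (bigD1 (Ordinal rm)) //= lerDl sumr_ge0// => i _.
have B0 : 0 <= B by apply: sumr_ge0.
near=> n.
have n0 : (0 < n)%N by near: n; exact: nbhs_infty_gt.
have nR : 0 < n%:R :> R by rewrite ltr0n.
have hn : 2 * (B + C) / e <= n%:R by near: n; exact: nbhs_infty_ger.
have hBC : B + C <= (e / 2) * n%:R.
  by move: hn; rewrite ler_pdivrMr//; lra.
have bn : b n <= n%:R * (b m.+1 / m.+1%:R) + B.
  rewrite [X in b X](divn_eq n m.+1).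
  have hr : b (n %% m.+1)%N <= B by apply: Br; rewrite ltn_mod.
  case hq : (n %/ m.+1)%N => [|q].
    by rewrite mul0n add0n (le_trans hr)// lerDr mulr_ge0// divr_ge0.
  apply: (le_trans (bD _ _)); apply: lerD => //.
  apply: (le_trans (bM _ _)); rewrite mulrA ler_pdivlMr// mulrAC ler_wpM2r//.
  by rewrite -natrM ler_nat -hq leq_trunc_div.
have := Slb n.-1; rewrite prednK// ler_pdivlMr// => Ln.
have bnE : b n = a n + C by [].
have en : 0 < e * n%:R by rewrite mulr_gt0.
have h2 : n%:R * (b m.+1 / m.+1%:R) <= n%:R * (L + e / 2).
  by rewrite ler_wpM2l// ltW.
have {}h2 := le_trans bn (lerD h2 (lexx B)).
have {}hBC : B + C <= e * n%:R / 2 by rewrite mulrAC.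
have e2 : n%:R * (L + e / 2) = L * n%:R + e * n%:R / 2 by field.
rewrite ler_distlC [_ * a n]mulrC ler_pdivlMr// ler_pdivrMr// !mulrDl mulNr.
rewrite bnE in h2 Ln; rewrite e2 in h2.
move: Ln h2 hBC en; set x := L * _; set y := e * _ => Ln h2 hBC en.
by apply/andP; split; lra.
Unshelve. all: by end_near. Qed.

Section Words.
Variables (R : realType) (lam : R).
Hypotheses (lam0 : 0 < lam) (lam1 : lam < 1).

(** Half the length of [Ilam]. As [pt s] is the image of the midpoint 0, the cylinder of a word of
    length [n] is the interval of radius [lam ^+ n * ell] about [pt s]; the same number is the mesh
    of the grid at level [n]. *)
Definition ell : R := (1 - lam)^-1.
Definition pt (s : seq bool) : R := compS lam s 0.

Lemma ell_gt0 : 0 < ell. Proof. by rewrite invr_gt0 subr_gt0. Qed.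

Lemma ellE : lam * ell + 1 = ell.
Proof. by rewrite /ell; field; rewrite subr_eq0 gt_eqF. Qed.

Lemma scale_gt0 n : 0 < lam ^+ n * ell.
Proof. by rewrite mulr_gt0 ?exprn_gt0 ?ell_gt0. Qed.

Lemma compSE s x : compS lam s x = pt s + lam ^+ size s * x.
Proof.
rewrite /pt; elim: s => [|b s IH] /=; first by rewrite expr0 mul1r add0r.
by rewrite /Smap IH exprS; ring.
Qed.

Lemma pt_cat s t : pt (s ++ t) = pt s + lam ^+ size s * pt t.
Proof. by rewrite {1}/pt /compS foldr_cat -/(compS lam s _) compSE. Qed.

Lemma pt_bound s : `|pt s| <= ell.
Proof.
rewrite /pt; elim: s => [|b s IH] /=; first by rewrite normr0 ltW ?ell_gt0.
rewrite /Smap -[leRHS]ellE (le_trans (ler_normD _ _))// lerD//.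
  by rewrite normrM (gtr0_norm lam0) ler_pM2l.
by case: b; rewrite ?normrN normr1.
Qed.

Lemma mem_compS_image s x :
  (compS lam s @` Ilam lam) x <-> `|x - pt s| <= lam ^+ size s * ell.
Proof.
have L0 : 0 < lam ^+ size s by rewrite exprn_gt0.
split.
- move=> [y]; rewrite /Ilam/= in_itv/= => /andP[y1 y2] <-.
  rewrite compSE addrC addKr normrM gtr0_norm// ler_pM2l//.
  by rewrite ler_norml y1.
- move=> h; exists ((x - pt s) / lam ^+ size s).
    rewrite /Ilam/= in_itv/=; rewrite ler_norml in h; case/andP: h => h1 h2.
    by rewrite ler_pdivlMr// ler_pdivrMr// mulNr -/ell ![ell * _]mulrC h1 h2.
  by rewrite compSE mulrC divfK ?gt_eqF// addrC subrK.
Qed.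

Lemma beta_nE n x :
  beta_n lam n x = #|[pred z : n.-tuple bool | `|x - pt z| <= lam ^+ n * ell]|.
Proof.
rewrite /beta_n; apply: eq_card => z; rewrite !inE/=.
apply/idP/idP => [/asboolP/asboolP|h].
  by move/mem_compS_image; rewrite size_tuple.
by apply/asboolP/asboolP/mem_compS_image; rewrite size_tuple.
Qed.

Definition wcell n (z : n.-tuple bool) : int := Num.floor (pt z / (lam ^+ n * ell)).

Lemma floor_near (K : nat) (a b : R) :
  `|a - b| <= K%:R -> `|Num.floor a - Num.floor b| <= K%:Z.
Proof.
move=> h; have /andP[a1 a2] := floor_itv a; have /andP[b1 b2] := floor_itv b.
rewrite ler_norml in h; case/andP: h => h1 h2.
have h3 : (Num.floor a - Num.floor b)%:~R < (K%:Z + 1)%:~R :> R.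
  by move: a1 a2 b1 b2; rewrite !intrD mulrNz; lra.
have h4 : (Num.floor b - Num.floor a)%:~R < (K%:Z + 1)%:~R :> R.
  by move: a1 a2 b1 b2; rewrite !intrD mulrNz; lra.
by move: h3 h4; rewrite !ltr_int; lia.
Qed.

Lemma floor_same (a b : R) : Num.floor a = Num.floor b -> `|a - b| <= 1.
Proof.
move=> e; have /andP[a1 a2] := floor_itv a; have /andP[b1 b2] := floor_itv b.
by move: a1 a2 b1 b2; rewrite e !intrD ler_norml; lra.
Qed.

Lemma floor_near_scaled n (K : nat) (x y : R) :
  `|x - y| <= K%:R * (lam ^+ n * ell) ->
  `|Num.floor (x / (lam ^+ n * ell)) - Num.floor (y / (lam ^+ n * ell))| <= K%:Z.
Proof.
move=> h; apply: floor_near; rewrite -mulrBl normrM [`|_^-1|]gtr0_norm ?invr_gt0 ?scale_gt0//.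
by rewrite ler_pdivrMr ?scale_gt0.
Qed.

Lemma wcell_same n (s t : n.-tuple bool) :
  wcell s = wcell t -> `|pt s - pt t| <= lam ^+ n * ell.
Proof.
move=> /floor_same; rewrite -mulrBl normrM [`|_^-1|]gtr0_norm ?invr_gt0 ?scale_gt0//.
by rewrite ler_pdivrMr ?scale_gt0// mul1r.
Qed.

Local Notation G := (cell_card (@wcell _)).

Definition gavg n : R := (2 ^+ n)^-1 * \sum_(z : n.-tuple bool) ln (G z)%:R.

Definition near_count n (z : n.-tuple bool) : nat :=
  #|[pred s : n.-tuple bool | `|wcell s - wcell z| <= 2%N%:Z]|.

Definition min_rank n (z : n.-tuple bool) : nat :=
  minn (rank_up (@wcell n) pt z) (rank_down (@wcell n) pt z).

(** One mesh for the tail [y] and one for the covering radius: covering words are at most two cells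
    away, which is the 2 in [near_count]. *)
Lemma beta_n_le n (z : n.-tuple bool) y : `|y| <= ell ->
  (beta_n lam n (compS lam z y) <= near_count z)%N.
Proof.
move=> yl; rewrite beta_nE; apply: subset_leq_card.
apply/fintype.subsetP => s; rewrite !inE compSE size_tuple => h.
apply: floor_near_scaled.
have : `|lam ^+ n * y| <= lam ^+ n * ell.
  by rewrite normrM gtr0_norm ?exprn_gt0// ler_pM2l ?exprn_gt0.
by move: h; rewrite !ler_norml; lra.
Qed.

(** The point is [pt z + lam ^+ n * y]. For [y >= 0] both it and the points of the cell at or above
    [pt z] lie within one mesh to the right of [pt z], hence within one mesh of each other; [y < 0]
    is symmetric. The minimum of the two ranks covers both signs. *)
Lemma beta_n_ge n (z : n.-tuple bool) y : `|y| <= ell ->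
  (min_rank z <= beta_n lam n (compS lam z y))%N.
Proof.
move=> yl; have L0 : 0 < lam ^+ n by rewrite exprn_gt0.
have yl' : `|lam ^+ n * y| <= lam ^+ n * ell by rewrite normrM gtr0_norm// ler_pM2l.
rewrite beta_nE /min_rank geq_min; case: (lerP 0 y) => y0.
- have y0' : 0 <= lam ^+ n * y by rewrite mulr_ge0// ltW.
  apply/orP; left; apply: subset_leq_card; apply/fintype.subsetP => s.
  rewrite !inE compSE size_tuple => /andP[/eqP /wcell_same].
  by move: yl'; rewrite !ler_norml; lra.
- have y0' : lam ^+ n * y <= 0 by rewrite nmulr_lle0// ltW.
  apply/orP; right; apply: subset_leq_card; apply/fintype.subsetP => s.
  rewrite !inE compSE size_tuple => /andP[/eqP /wcell_same].
  by move: yl'; rewrite !ler_norml; lra.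
Qed.

Lemma card_words n : #|{: n.-tuple bool}|%:R = 2 ^+ n :> R.
Proof. by rewrite card_tuple card_bool natrX. Qed.

(** After exchanging the sums, each [s] sees at most [2 * K + 1] cells of words [z], each of total
    weight at most one. This bounds the mean ratio of neighbourhood size to cell size, the input for
    Jensen's inequality. *)
Lemma near_count_sum n K :
  \sum_(z : n.-tuple bool) \sum_(s : n.-tuple bool | `|wcell s - wcell z| <= K%:Z)
     ((G z)%:R : R)^-1 <= (2 * K + 1)%:R * 2 ^+ n.
Proof.
rewrite (exchange_big_dep xpredT) //=.
rewrite -card_words -sum1_card natr_sum mulr_sumr; apply: ler_sum => s _; rewrite mulr1.
under eq_bigl => z do rewrite distrC.
exact: sum_inv_near_cells.
Qed.

Lemma near_count_gt0 n (z : n.-tuple bool) : (0 < near_count z)%N.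
Proof. by apply/card_gt0P; exists z; rewrite inE subrr normr0. Qed.

Lemma min_rank_gt0 n (z : n.-tuple bool) : (0 < min_rank z)%N.
Proof. by rewrite leq_min rank_up_gt0 rank_down_gt0. Qed.

Lemma avg_near_count n :
  (2 ^+ n)^-1 * \sum_(z : n.-tuple bool) ln (near_count z)%:R <= gavg n + ln 5.
Proof.
have N0 : 0 < 2 ^+ n :> R by rewrite exprn_gt0.
pose f (z : n.-tuple bool) : R := (near_count z)%:R / (G z)%:R.
have f0 z : 0 < f z by rewrite divr_gt0// ltr0n ?near_count_gt0 ?cell_card_gt0.
have := @ln_sum_le R _ f 5 (ltr0n _ 5) f0; rewrite card_words => h.
have {h} /h : \sum_t f t <= 5 * 2 ^+ n.
  apply: le_trans (near_count_sum n 2); apply: ler_sum => z _.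
  by rewrite sumr_const -[_ *+ _]mulr_natl.
rewrite (eq_bigr (fun z : n.-tuple bool => ln (near_count z)%:R - ln (G z)%:R)); last first.
  by move=> z _; rewrite ln_div ?posrE// ltr0n ?near_count_gt0 ?cell_card_gt0.
rewrite sumrB lerBlDr -(ler_pM2l (_ : 0 < (2 ^+ n)^-1)) ?invr_gt0// mulrDr mulKf ?gt_eqF//.
by rewrite addrC.
Qed.

Lemma avg_min_rank n :
  gavg n - 2 <= (2 ^+ n)^-1 * \sum_(z : n.-tuple bool) ln (min_rank z)%:R.
Proof.
have N0 : 0 < 2 ^+ n :> R by rewrite exprn_gt0.
have := @sum_ln_min_rank R _ (@wcell n) pt.
rewrite sumrB sumr_const -[2 *+ _]mulr_natl card_words => h.
rewrite -(ler_pM2l (_ : 0 < (2 ^+ n)^-1)) ?invr_gt0// mulrBr mulKf ?gt_eqF// in h.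
Qed.

Lemma cat_tuple_bij n m :
  bijective (fun z : n.-tuple bool * m.-tuple bool => [tuple of z.1 ++ z.2]).
Proof.
apply: inj_card_bij; last by rewrite card_prod !card_tuple expnD.
move=> [a b] [a' b'] /(congr1 val) /= /eqP.
rewrite eqseq_cat ?size_tuple// => /andP[/eqP h /eqP h'].
by congr pair; exact: val_inj.
Qed.

(** Jensen's inequality for the ratio [f] of the cell size of a concatenation to the product of the
    cell sizes of its parts. The mean of [f] is at most [21 = 7 * 3], with 7 cells for the first
    part and 3 for the second. *)
Lemma gavgD n m : gavg (n + m) <= gavg n + gavg m + ln 21.
Proof.
have N0 k : 0 < 2 ^+ k :> R by rewrite exprn_gt0.
pose W := (n.-tuple bool * m.-tuple bool)%type.
pose J (z : W) : (n + m).-tuple bool := [tuple of z.1 ++ z.2].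
have cW : #|{: W}|%:R = 2 ^+ n * 2 ^+ m :> R by rewrite card_prod natrM !card_words.
pose f (z : W) : R := (G (J z))%:R / ((G z.1)%:R * (G z.2)%:R).
have G0 k (z : k.-tuple bool) : 0 < (G z)%:R :> R by rewrite ltr0n cell_card_gt0.
have f0 z : 0 < f z by rewrite divr_gt0// mulr_gt0.
have := @ln_sum_le R _ f 21 (ltr0n _ 21) f0; rewrite cW.
have -> : \sum_z ln (f z) = 2 ^+ n * 2 ^+ m * (gavg (n + m) - gavg n - gavg m).
  rewrite (eq_bigr (fun z => ln (G (J z))%:R - ln (G z.1)%:R - ln (G z.2)%:R)); last first.
    by move=> z _; rewrite ln_div ?posrE ?mulr_gt0// lnM ?posrE// opprD addrA.
  rewrite !sumrB.
  have -> : \sum_z ln (G (J z))%:R = 2 ^+ n * 2 ^+ m * gavg (n + m).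
    rewrite /gavg -exprD mulVKf ?gt_eqF//.
    by rewrite (reindex J) //; apply: onW_bij; exact: cat_tuple_bij.
  have -> : \sum_(z : W) ln (G z.1)%:R = 2 ^+ n * 2 ^+ m * gavg n.
    rewrite -(pair_big xpredT xpredT (fun (a : n.-tuple bool) (b : m.-tuple bool) => ln (G a)%:R)) /=.
    under eq_bigr do rewrite sumr_const -[_ *+ _]mulr_natl card_words.
    by rewrite -mulr_sumr /gavg mulrAC mulVKf ?gt_eqF// mulrC.
  have -> : \sum_(z : W) ln (G z.2)%:R = 2 ^+ n * 2 ^+ m * gavg m.
    rewrite -(pair_big xpredT xpredT (fun (a : n.-tuple bool) (b : m.-tuple bool) => ln (G b)%:R)) /=.
    rewrite sumr_const -[_ *+ _]mulr_natl card_words /gavg -mulrA mulVKf ?gt_eqF//.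
  by ring.
rewrite ler_pM2l ?mulr_gt0// => h; suff {h}/h : \sum_t f t <= 21 * (2 ^+ n * 2 ^+ m) by lra.
(* Two words in one cell have first parts at most 3 meshes apart: one for the cell and one for each
   tail. The displacement of the first parts, rescaled by [lam ^- n], is [t]; up to it the second
   parts agree to within one mesh of level [m]. *)
pose A (a a' : n.-tuple bool) := `|wcell a' - wcell a| <= 3%N%:Z.
pose t (a a' : n.-tuple bool) := (pt a - pt a') / lam ^+ n.
pose B a a' (b b' : m.-tuple bool) :=
  `|wcell b - Num.floor ((pt b' - t a a') / (lam ^+ m * ell))| <= 1%N%:Z.
have GJ z : ((G (J z))%:R : R) <= \sum_(a' | A z.1 a') \sum_(b' | B z.1 a' z.2 b') 1.
  rewrite pair_big_dep /= sumr_const ler_nat.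
  have [K JK KJ] := cat_tuple_bij n m.
  rewrite /cell_card -(card_imset _ (can_inj KJ)).
  apply: subset_leq_card; apply/fintype.subsetP => z' /imsetP[s /eqP es ->].
  have ls : s = J (K s) by rewrite /J KJ.
  move: (wcell_same es); rewrite ls; move: (K s) => {s es ls} [a' b'] /=.
  case: z => a b /=; rewrite -[K _]/(K (J (a', b'))) JK unfold_in /A /B /=.
  rewrite /= !pt_cat !size_tuple exprD => h.
  have h1 := pt_bound b; have h2 := pt_bound b'.
  have Ln : 0 < lam ^+ n by rewrite exprn_gt0.
  have Lm : lam ^+ m <= 1 by rewrite exprn_ile1 ?ltW.
  have e0 := ell_gt0.
  apply/andP; split; apply: floor_near_scaled.
  - have {}h : `|pt a' + lam ^+ n * pt b' - (pt a + lam ^+ n * pt b)| <= lam ^+ n * ell.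
      by apply: (le_trans h); rewrite -mulrA ler_pM2l// ler_piMl// ltW.
    have {}h1 : `|lam ^+ n * pt b| <= lam ^+ n * ell by rewrite normrM gtr0_norm// ler_pM2l.
    have {}h2 : `|lam ^+ n * pt b'| <= lam ^+ n * ell by rewrite normrM gtr0_norm// ler_pM2l.
    by move: h h1 h2; rewrite !ler_norml; lra.
  - rewrite mul1r -(ler_pM2l Ln) -{1}(gtr0_norm Ln) -normrM -normrN mulrA.
    apply: le_trans h; rewrite le_eqVlt; apply/orP; left; apply/eqP; congr `|_|.
    by rewrite /t; field; rewrite gt_eqF.
apply: (@le_trans _ _ (\sum_(a : n.-tuple bool) \sum_(a' | A a a') ((G a)%:R)^-1 * (3 * 2 ^+ m))).
  rewrite /W -(pair_big xpredT xpredT (fun a b => f (a, b))) /=.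
  apply: ler_sum => a _.
  apply: (@le_trans _ _ (\sum_(b : m.-tuple bool) \sum_(a' | A a a') \sum_(b' | B a a' b b')
      ((G a)%:R^-1 * (G b)%:R^-1))).
    apply: ler_sum => b _; rewrite /f /= invfM.
    apply: (le_trans (ler_wpM2r _ (GJ (a, b)))); first by rewrite mulr_ge0// invr_ge0.
    rewrite mulr_suml; apply: ler_sum => a' _; rewrite mulr_suml; apply: ler_sum => b' _.
    by rewrite mul1r.
  rewrite exchange_big /=; apply: ler_sum => a' _.
  (* The weight [1 / G b] belongs to the second part of the given word, so [b] is summed before
     [b']: for fixed [b'] it ranges over 3 cells. *)
  rewrite (exchange_big_dep xpredT) //=.
  under eq_bigr do rewrite -mulr_sumr.
  rewrite -mulr_sumr ler_wpM2l ?invr_ge0//.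
  rewrite -card_words -sum1_card natr_sum mulr_sumr; apply: ler_sum => b' _; rewrite mulr1.
  exact: (sum_inv_near_cells _ _ 1).
under eq_bigr do rewrite -mulr_suml.
rewrite -mulr_suml; have := near_count_sum n 3; have := N0 m; nra.
Qed.

End Words.

(** * The Bernoulli measure and the coding map *)

Section Symbolic.

Definition ext (z : seq bool) : nat -> bool := nth false z.

Lemma prefix_ext n (z : n.-tuple bool) : prefix (ext z) n = z.
Proof. by rewrite /prefix /ext -{2}(size_tuple z); exact: mkseq_nth. Qed.

Lemma eq_prefix n (v w : nat -> bool) :
  (forall i, (i < n)%N -> v i = w i) <-> prefix v n = prefix w n.
Proof.
split=> [h|h i lin].
  by rewrite /prefix /mkseq; apply/eq_in_map => i; rewrite mem_iota => /h.
by rewrite -(nth_mkseq false v lin) -(nth_mkseq false w lin) -!/(prefix _ n) h.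
Qed.

Lemma cylE n u (w : Sigma2) : cyl n u w <-> prefix w n = prefix u n.
Proof. exact: eq_prefix. Qed.

Lemma size_prefix_word w n : size (prefix w n) = n.
Proof. exact: size_mkseq. Qed.

Definition prefix_tuple (w : Sigma2) n : n.-tuple bool :=
  Tuple (introT eqP (size_prefix_word w n)).

Lemma cyl_ext n (z : n.-tuple bool) (w : Sigma2) :
  cyl n (ext z) w <-> prefix_tuple w n = z.
Proof.
rewrite cylE prefix_ext; split=> [h|<-//].
exact: val_inj.
Qed.

Lemma iter_shift k (w : Sigma2) i : iter k shift w i = w (k + i)%N.
Proof. by elim: k i => [//|k IH] i; rewrite iterS /shift IH addnS. Qed.

Lemma prefix_iter_shift n m (w : Sigma2) :
  prefix w (n + m) = prefix w n ++ prefix (iter n shift w) m.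
Proof.
rewrite /prefix /mkseq iotaD map_cat; congr (_ ++ _).
rewrite add0n -{1}(addn0 n) iotaDl -map_comp; apply: eq_map => i /=.
by rewrite iter_shift.
Qed.

Lemma measurable_cyl n u : measurable (cyl n u : set Sigma2).
Proof. by apply: sub_sigma_algebra; exists n, u. Qed.

(** Two cylinders are nested or disjoint, so adjoining the empty set gives a pi-system, as
    uniqueness of measures requires. *)
Lemma cylI_closed : setI_closed (cylinders `|` [set set0]).
Proof.
have sym A B : (cylinders `|` [set set0]) (A `&` B) -> (cylinders `|` [set set0]) (B `&` A).
  by rewrite setIC.
move=> A B [[n [u ->]]|->] [[m [v ->]]|->]; rewrite ?(set0I, setI0); try by right.
wlog nm : n m u v / (n <= m)%N.
  move=> h; case: (leqP n m) => [|/ltnW] nm; first exact: h.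
  by apply: sym; apply: h.
case: (pselect (forall i, (i < n)%N -> u i = v i)) => [uv|uv].
- left; exists m, v; apply/seteqP; split => [w [_ //]|w mw]; split => // i lin.
  by rewrite uv//; apply: mw; exact: leq_trans nm.
- right; apply/seteqP; split => // w [nw mw]; apply: uv => i lin.
  by rewrite -nw// -mw//; exact: leq_trans nm.
Qed.

Lemma measurable_Sigma2E : (measurable : set (set Sigma2)) = <<s cylinders `|` [set set0] >>.
Proof.
apply/seteqP; split.
- apply: smallest_sub; first exact: smallest_sigma_algebra.
  by move=> A cA; apply: sub_sigma_algebra; left.
- apply: smallest_sub; first exact: sigma_algebra_measurable.
  move=> A [cA|->]; last exact: measurable0.
  exact: sub_sigma_algebra.
Qed.

Lemma measurable_prefix_set n (D : set Sigma2) :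
  (forall v w : Sigma2, prefix v n = prefix w n -> D v -> D w) -> measurable D.
Proof.
move=> hD.
have -> : D = \bigcup_(z in [set z : n.-tuple bool | D (ext z)]) cyl n (ext z).
  apply/seteqP; split => [w Dw|w [z /= Dz /cyl_ext e]].
    exists (prefix_tuple w n); last by apply/cyl_ext.
    by apply: hD Dw; rewrite prefix_ext.
  by apply: hD Dz; rewrite prefix_ext -e.
by apply: fin_bigcup_measurable => // z _; exact: measurable_cyl.
Qed.

Lemma measurable_fun_prefix d (T : measurableType d) n (f : Sigma2 -> T) :
  (forall v w : Sigma2, prefix v n = prefix w n -> f v = f w) -> measurable_fun setT f.
Proof.
move=> hf _ A _; rewrite setTI; apply: (@measurable_prefix_set n) => v w e.
by rewrite /preimage /= (hf _ _ e).
Qed.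

Lemma measurable_shift : measurable_fun setT shift.
Proof.
apply: (@measurability _ _ _ _ setT shift cylinders) => //.
move=> _ [_ [n [u ->]] <-]; rewrite setTI.
apply: (@measurable_prefix_set n.+1) => v w /eq_prefix e h i lin.
by rewrite /shift -e//; exact: h.
Qed.

Lemma measurable_iter_shift n : measurable_fun setT (iter n shift).
Proof.
elim: n => [|n IH]; first exact: measurable_id.
by apply: (measurableT_comp measurable_shift IH).
Qed.

Lemma Sigma2_measure_unique (R : realType) (m1 m2 : {measure set Sigma2 -> \bar R}) :
  (m1 setT < +oo)%E -> (forall n u, m1 (cyl n u) = m2 (cyl n u)) ->
  forall A, measurable A -> m1 A = m2 A.
Proof.
move=> m1oo h; have cT : setT = cyl 0 (fun=> false) :> set Sigma2.
  by apply/seteqP; split.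
move=> A mA; apply: (@measure_unique _ R Sigma2 (cylinders `|` [set set0]) (fun=> [set: Sigma2])) => //.
- exact: measurable_Sigma2E.
- exact: cylI_closed.
- by move=> n; left; exists 0%N, (fun=> false).
- by rewrite bigcup_const//; exists 0%N.
- by move=> B [[n [u ->]]//|->]; rewrite !measure0.
Qed.

End Symbolic.

Section FiniteValued.
Context {d} {T : measurableType d} {R : realType} {I : finType} (Z : T -> I).
Hypothesis mZ : forall z, measurable (Z @^-1` [set z]).

Lemma measurable_finite_preimage (A : set I) : measurable (Z @^-1` A).
Proof.
rewrite (_ : Z @^-1` A = \bigcup_(z in A) (Z @^-1` [set z])).
  by apply: fin_bigcup_measurable => // z _; exact: mZ.
by apply/seteqP; split => [p Ap|p [z Az /= e]]; [exists (Z p)|rewrite /preimage /= e].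
Qed.

Lemma measurable_finite_fun d' (U : measurableType d') (f : I -> U) :
  measurable_fun setT (f \o Z).
Proof.
by move=> _ A _; rewrite setTI comp_preimage; exact: measurable_finite_preimage.
Qed.

Lemma finite_integral (m : {measure set T -> \bar R}) (f : I -> R) :
  (forall z, 0 <= f z) ->
  (\int[m]_p (f (Z p))%:E = \sum_z (f z)%:E * m (Z @^-1` [set z]))%E.
Proof.
move=> f0.
under eq_integral => p _.
  rewrite (_ : (f (Z p))%:E =
     \sum_(z <- index_enum I) ((f z)%:E * (\1_(Z @^-1` [set z]) p)%:E)%E)%E; last first.
    rewrite (bigD1 (Z p)) //= big1 ?adde0; first by rewrite indicE mem_set//= mule1.
    move=> z zp; have nz : ~ (Z @^-1` [set z]) p.
      by move=> /= e; move: zp; rewrite e eqxx.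
    by rewrite indicE memNset//= mule0.
  over.
have mi z : measurable_fun setT (fun p => (\1_(Z @^-1` [set z]) p)%:E : \bar R).
  by apply/measurable_EFinP; apply: measurable_indic; exact: mZ.
rewrite ge0_integral_sum//; last 2 first.
- by move=> z; apply: measurable_funeM; exact: mi.
- by move=> z p _; rewrite mule_ge0// lee_fin.
apply: eq_bigr => z _; rewrite ge0_integralZl//; last by rewrite lee_fin.
by rewrite integral_indic ?setIT//; exact: mZ.
Qed.

End FiniteValued.

Lemma measurable_prefix_tuple n (z : n.-tuple bool) :
  measurable ((fun w : Sigma2 => prefix_tuple w n) @^-1` [set z]).
Proof.
by apply: (@measurable_prefix_set n) => v w e; rewrite /preimage /= => <-; apply: val_inj; rewrite /= e.
Qed.


Section Bernoulli.
Variables (R : realType) (P : probability Sigma2 R).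
Hypothesis hP : is_uniform_bernoulli P.

(** Both sides are finite measures in [A], and they agree on cylinders because the intersection is
    again a cylinder, that of the concatenated word. *)
Lemma bernoulli_indep n u (A : set Sigma2) : measurable A ->
  P (cyl n u `&` iter n shift @^-1` A) = (((2 : R) ^- n)%:E * P A)%E.
Proof.
move=> mA.
pose m1 : {measure set Sigma2 -> \bar R} :=
  pushforward (mrestr P (measurable_cyl n u)) (@iter Sigma2 n shift).
have c0 : 0 <= (2 : R) ^- n by rewrite invr_ge0 exprn_ge0.
pose m2 : {measure set Sigma2 -> \bar R} := mscale (NngNum c0) P.
rewrite setIC; have := @Sigma2_measure_unique R (m1 (measurable_iter_shift n)) m2 _ _ A mA; apply.
  rewrite /m1 /= /pushforward /mrestr /=.
  apply: le_lt_trans (ltry 1); apply: probability_le1.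
  by apply: measurableI; rewrite ?preimage_setT//; exact: measurable_cyl.
move=> k v; rewrite /m1 /m2 /= /pushforward /mrestr /mscale /= setIC.
pose w i := if (i < n)%N then u i else v (i - n)%N.
have -> : cyl n u `&` iter n shift @^-1` cyl k v = cyl (n + k) w.
  apply/seteqP; split => x.
    move=> [xu xv] i lin; rewrite /w; case: ltnP => ni; first exact: xu.
    by rewrite -[in LHS](subnKC ni) -iter_shift; apply: xv; lia.
  move=> h; split => i lin.
    by rewrite h; [rewrite /w lin|lia].
  rewrite iter_shift h; last by lia.
  by rewrite /w ltnNge leq_addr /= addKn.
rewrite !hP -EFinM; congr EFin.
by rewrite exprD invfM.
Qed.

Lemma bernoulli_shift (A : set Sigma2) : measurable A -> P (shift @^-1` A) = P A.
Proof.
move=> mA; have m1 : measurable (shift @^-1` A).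
  by rewrite -[_ @^-1` _]setTI; exact: measurable_shift.
have -> : shift @^-1` A = (cyl 1 (fun=> false) `&` iter 1 shift @^-1` A) `|`
                          (cyl 1 (fun=> true) `&` iter 1 shift @^-1` A).
  rewrite -setIUl; apply/seteqP; split => [w Aw|w []//]; split => //.
  case e : (w 0%N); [right|left] => i; rewrite ltnS leqn0 => /eqP ->; by rewrite e.
rewrite measureU; last 3 first.
- by apply: measurableI => //; exact: measurable_cyl.
- by apply: measurableI => //; exact: measurable_cyl.
- by apply/seteqP; split => // w [[h1 _] [h2 _]]; have := h1 0%N isT; rewrite h2.
have h0 := bernoulli_indep 1 (fun=> false) mA; have h1 := bernoulli_indep 1 (fun=> true) mA.
rewrite [X in (X + _)%E]h0 [X in (_ + X)%E]h1 -ge0_muleDl ?lee_fin ?invr_ge0// -EFinD.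
by rewrite expr1 -{1}[2^-1]mul1r -{2}[2^-1]mul1r -splitr mul1e.
Qed.

Lemma bernoulli_iter_shift n (A : set Sigma2) :
  measurable A -> P (iter n shift @^-1` A) = P A.
Proof.
move=> mA; elim: n => [//|n IH]; rewrite -IH -(@bernoulli_shift (iter n shift @^-1` A)).
  by congr (P _); apply/seteqP; split => w; rewrite /preimage /= -iterSr.
by rewrite -[_ @^-1` _]setTI; exact: measurable_iter_shift.
Qed.

(** As [shift] preserves [P], the inclusion makes [V] equal to each of its iterated shift preimages
    up to a null set, hence independent of the first [n] letters for every [n], hence of itself. *)
Lemma bernoulli_zero_one (V : set Sigma2) : measurable V ->
  shift @^-1` V `<=` V -> P V = 0%E \/ P V = 1%E.
Proof.
move=> mV sV.
have mit n (A : set Sigma2) : measurable A -> measurable (iter n shift @^-1` A).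
  by move=> mA; rewrite -[_ @^-1` _]setTI; exact: measurable_iter_shift.
have sVn n : iter n shift @^-1` V `<=` V.
  elim: n => [//|n IH] w h; apply: IH; exact: sV.
have fV : P V \is a fin_num by exact: fin_num_measure.
have cV n u : P (cyl n u `&` V) = (P V * ((2 : R) ^- n)%:E)%E.
  rewrite muleC -(bernoulli_indep n u mV).
  have mc := measurable_cyl n u.
  have mD : measurable (V `\` iter n shift @^-1` V) by apply: measurableD => //; exact: mit.
  have D0 : P (V `\` iter n shift @^-1` V) = 0%E.
    rewrite measureD//; last 2 first.
    - exact: mit.
    - by rewrite -ge0_fin_numE.
    by rewrite setIidr// [X in (_ - X)%E](bernoulli_iter_shift n mV) subee.
  have -> : cyl n u `&` V = (cyl n u `&` iter n shift @^-1` V) `|`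
      (cyl n u `&` (V `\` iter n shift @^-1` V)).
    apply/seteqP; split => [w [cw Vw]|w [[cw /sVn Vw]|[cw [Vw _]]]]; [|by split|by split].
    by case: (pselect ((iter n shift @^-1` V) w)) => h; [left|right].
  rewrite measureU; last 3 first.
  - by apply: measurableI => //; exact: mit.
  - by apply: measurableI.
  - by apply/seteqP; split => // w [[_ h1] [_ [_ h2]]].
  rewrite [X in (_ + X)%E](_ : _ = 0%E) ?adde0//.
  apply/eqP; rewrite eq_le measure_ge0 andbT -D0; apply: le_measure.
  - by rewrite inE; exact: measurableI.
  - by rewrite inE.
  - exact: subIsetr.
pose p := fine (P V).
have PV : P V = p%:E by rewrite fineK.
have p0 : 0 <= p by rewrite fine_ge0.
have : P (V `&` V) = (p%:E * P V)%E.
  apply: (@Sigma2_measure_unique R (mrestr P mV) (mscale (NngNum p0) P)) => //.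
    by rewrite /= /mrestr setTI PV ltry.
  by move=> n u; rewrite /= /mrestr /mscale /= cV PV hP.
rewrite setIid PV.
rewrite -EFinM => -[] /eqP; rewrite -subr_eq0 -{1}[p]mulr1 -mulrBr mulf_eq0 subr_eq0.
by move=> /orP[/eqP ->|/eqP <-]; [left|right].
Qed.

Lemma prefix_integral_bernoulli n (f : n.-tuple bool -> R) :
  (forall z, 0 <= f z) ->
  (\int[P]_w (f (prefix_tuple w n))%:E = ((2 ^+ n)^-1 * \sum_z f z)%:E)%E.
Proof.
move=> f0; rewrite (finite_integral (@measurable_prefix_tuple n))//.
rewrite mulrC mulr_suml -sumEFin; apply: eq_bigr => z _.
rewrite EFinM -(hP n (ext z)); congr (_ * P _)%E.
by apply/seteqP; split => w /=; [move=> e; apply/cyl_ext|move/cyl_ext].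
Qed.

End Bernoulli.

Section Coding.
Variables (R : realType) (lam : R).
Hypotheses (lam0 : 0 < lam) (lam1 : lam < 1).
Local Notation ell := (ell lam).
Local Notation pt := (pt lam).

Lemma pt_prefix_dist (w : Sigma2) n k : `|pt (prefix w (n + k)) - pt (prefix w n)| <= lam ^+ n * ell.
Proof.
rewrite prefix_iter_shift pt_cat size_prefix_word addrC addKr normrM gtr0_norm ?exprn_gt0//.
by rewrite ler_pM2l ?exprn_gt0// pt_bound.
Qed.

Lemma cvg_geo_ell : (fun n => lam ^+ n * ell) @ \oo --> (0 : R).
Proof.
rewrite -(mul0r ell); apply: cvgMl; apply: cvg_expr.
by rewrite gtr0_norm.
Qed.

Lemma geo_ell_small (e : R) : 0 < e -> \forall n \near \oo, lam ^+ n * ell < e.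
Proof.
move=> e0; have /cvgrPdist_lt/(_ _ e0) := cvg_geo_ell.
apply: filterS => n; rewrite sub0r normrN gtr0_norm//.
by rewrite mulr_gt0 ?exprn_gt0 ?ell_gt0.
Qed.

Lemma coding_is_cvg (w : Sigma2) : cvg ((fun n => pt (prefix w n)) @ \oo).
Proof.
apply/cauchy_cvgP/cauchy_exP => e e0.
have [N _ hN] := geo_ell_small e0.
exists (pt (prefix w N)); exists N => // m /= Nm.
rewrite /ball /= distrC -(subnKC Nm).
by apply: (le_lt_trans (pt_prefix_dist _ _ _)); exact: (hN N (leqnn N)).
Qed.

Lemma coding_dist (w : Sigma2) n : `|coding lam w - pt (prefix w n)| <= lam ^+ n * ell.
Proof.
apply/ler_addgt0Pr => e e0.
have /cvgrPdist_le/(_ _ e0) [N _ hN] := @coding_is_cvg w.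
have := hN (n + N)%N (leq_addl _ _); have := pt_prefix_dist w n N.
rewrite /= -/(coding lam w) => h1 h2.
have -> : coding lam w - pt (prefix w n) =
  (coding lam w - pt (prefix w (n + N))) + (pt (prefix w (n + N)) - pt (prefix w n)).
  by rewrite addrA subrK.
by apply: (le_trans (ler_normD _ _)); rewrite addrC lerD.
Qed.

Lemma coding_bound (w : Sigma2) : `|coding lam w| <= ell.
Proof. by have := coding_dist w 0; rewrite /pt /= subr0 expr0 mul1r. Qed.

Lemma coding_prefix (w : Sigma2) n :
  coding lam w = compS lam (prefix w n) (coding lam (iter n shift w)).
Proof.
apply/eqP; rewrite -subr_eq0 -normr_le0.
apply/ler_addgt0Pr => e e0; rewrite add0r.
have e20 : 0 < e / 2 by rewrite divr_gt0.
have [m _ hm] := geo_ell_small e20.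
have h0 := hm (n + m)%N (leq_addl _ _).
have h1 := coding_dist w (n + m).
have := coding_dist (iter n shift w) m.
rewrite -(ler_pM2l (_ : 0 < lam ^+ n)) ?exprn_gt0// mulrA -exprD => h2.
rewrite -{1}(gtr0_norm (_ : 0 < lam ^+ n)) ?exprn_gt0// -normrM in h2.
rewrite compSE size_prefix_word; move: h0 h1 h2.
rewrite prefix_iter_shift pt_cat size_prefix_word /=.
by rewrite !ler_norml; lra.
Qed.

Lemma coding_shift (w : Sigma2) : coding lam w = Smap lam (w 0%N) (coding lam (shift w)).
Proof. exact: (coding_prefix w 1). Qed.

Lemma measurable_coding : measurable_fun setT (coding lam : Sigma2 -> R).
Proof.
apply: (@measurable_fun_cvg _ _ _ _ (fun n (w : Sigma2) => pt (prefix w n))).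
- by move=> n; apply: (@measurable_fun_prefix _ _ n) => v w ->.
- by move=> w _; exact: coding_is_cvg.
Qed.

End Coding.

(** * Entropy of invariant measures of the lift *)

Lemma sum_tuple_prod (R : realType) (n : nat) (J : finType) (F : 'I_n -> J -> R) :
  \sum_(t : n.-tuple J) \prod_(i < n) F i (tnth t i) = \prod_(i < n) \sum_a F i a.
Proof.
rewrite bigA_distr_bigA (reindex (fun f : {ffun 'I_n -> J} => [tuple f i | i < n])) /=.
  by apply: eq_bigr => f _; apply: eq_bigr => i _; rewrite tnth_mktuple.
exists (fun t : n.-tuple J => [ffun i => tnth t i]) => [f _|t _].
  by apply/ffunP => i; rewrite ffunE tnth_mktuple.
by apply: eq_from_tnth => i; rewrite tnth_mktuple ffunE.
Qed.

(** The tangent line [ln x <= x - 1] at [q i / p i]. Only an upper bound on the mass of [q] enters,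
    so sub-probabilities serve as codes. *)
Lemma gibbs (R : realType) (I : finType) (p q : I -> R) :
  (forall i, 0 <= p i) -> (forall i, 0 < q i) -> \sum_i q i <= \sum_i p i ->
  \sum_i - (p i * ln (p i)) <= \sum_i p i * (- ln (q i)).
Proof.
move=> p0 q0 qp; rewrite -subr_ge0 -sumrB.
apply: (@le_trans _ _ (\sum_i (p i - q i))); first by rewrite sumrB subr_ge0.
apply: ler_sum => i _; have := p0 i; rewrite le_eqVlt => /orP[/eqP <-|pi].
  by rewrite !mul0r oppr0 subrr sub0r oppr_le0 ltW.
have := @ln_le_sub1 R (q i / p i); rewrite divr_gt0// => /(_ isT).
rewrite ln_div ?posrE// => h.
have {h} := ler_wpM2l (p0 i) h; rewrite !mulrBr mulr1 mulrCA mulfV ?gt_eqF//.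
by rewrite mulr1; lra.
Qed.

Section CodeLength.
Context {d} {T : measurableType d} {R : realType} (mu : probability T R).
Context {I J : finType} (X : T -> I) (Y : T -> J) (q : I * J -> R).
Hypotheses (mX : forall a, measurable (X @^-1` [set a]))
  (mY : forall b, measurable (Y @^-1` [set b])).
Hypotheses (q0 : forall z, 0 < q z) (q1 : \sum_z q z <= 1).

(** Gibbs' inequality for the pair, together with the fact that forgetting [Y] lowers entropy. [Y]
    carries side information that is encoded along with [X] and makes [X] cheap to describe. *)
Lemma entropy_le_code_length :
  ((\sum_a - (fine (mu (X @^-1` [set a])) * ln (fine (mu (X @^-1` [set a])))))%:E
   <= \int[mu]_p (- ln (q (X p, Y p)))%:E)%E.
Proof.
pose Z p := (X p, Y p).
have ZE a b : Z @^-1` [set (a, b)] = X @^-1` [set a] `&` Y @^-1` [set b].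
  by apply/seteqP; split => p /=; [move=> [-> ->]|move=> [<- <-]].
have mZ z : measurable (Z @^-1` [set z]).
  by case: z => a b; rewrite ZE; exact: measurableI.
have qle z : q z <= 1.
  apply: le_trans q1; rewrite (bigD1 z) //= lerDl sumr_ge0// => z' _.
  exact: ltW.
rewrite (finite_integral mZ mu (f := fun z => - ln (q z))); last first.
  by move=> z; rewrite oppr_ge0 ln_le0.
pose p z : R := fine (mu (Z @^-1` [set z])).
have pE z : mu (Z @^-1` [set z]) = (p z)%:E by rewrite fineK// fin_num_measure.
have p0 z : 0 <= p z by rewrite fine_ge0.
rewrite [leRHS](_ : _ = (\sum_z p z * (- ln (q z)))%:E); last first.
  by rewrite -sumEFin; apply: eq_bigr => z _; rewrite [X in (_ * X)%E]pE -EFinM mulrC.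
rewrite lee_fin.
have pX a : fine (mu (X @^-1` [set a])) = \sum_b p (a, b).
  have h := @finite_integral _ _ R _ Y mY (mrestr mu (mX a)) (fun=> 1) (fun=> ler01).
  have : mrestr mu (mX a) setT = (\sum_b p (a, b))%:E.
    rewrite -sumEFin -[LHS]mul1e -(integral_cst (mrestr mu (mX a)) measurableT 1) h.
    by apply: eq_bigr => b _; rewrite mul1e -pE ZE setIC.
  by rewrite /mrestr setTI => ->.
have psum : \sum_z p z = 1.
  have h := @finite_integral _ _ R _ Z mZ mu (fun=> 1) (fun=> ler01).
  apply: EFin_inj; rewrite -(probability_setT mu).
  rewrite -[RHS]mul1e -(integral_cst mu measurableT 1) h -sumEFin.
  by apply: eq_bigr => z _; rewrite mul1e -pE.
apply: le_trans (gibbs p0 q0 _); last by rewrite psum.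
rewrite [leRHS](eq_bigr (fun z => - (p (z.1, z.2) * ln (p (z.1, z.2))))); last by case.
rewrite -(pair_big xpredT xpredT (fun a b => - (p (a, b) * ln (p (a, b))))) /=.
apply: ler_sum => a _; rewrite pX mulr_suml -sumrN; apply: ler_sum => b _.
rewrite lerN2; have := p0 (a, b); rewrite le_eqVlt => /orP[/eqP <-|pab].
  by rewrite !mul0r.
have le : p (a, b) <= \sum_b p (a, b) by rewrite (bigD1 b) //= lerDl sumr_ge0.
by rewrite ler_pM2l// ler_ln ?posrE// (lt_le_trans pab).
Qed.

End CodeLength.

(** * Approximation by events observing finitely many letters and thresholds *)

Section Approximation.
Context {R : realType} (mu : probability (Sigma2 * R)%type R).
Local Notation Om := (Sigma2 * R)%type.

(** Thresholds, rather than general fibre sets, are recorded because half-lines generate the Borel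
    sets and the monotonicity of the fibre maps then keeps the number of itineraries polynomial. *)
Definition same_data (m : nat) (F : seq R) (p q : Om) :=
  prefix p.1 m = prefix q.1 m /\ {in F, forall c, (p.2 <= c) = (q.2 <= c)}.

Definition finite_data (D : set Om) :=
  exists m F, forall p q, same_data m F p q -> D p -> D q.

Lemma same_data_sym m F p q : same_data m F p q -> same_data m F q p.
Proof. by move=> [e h]; split => [//|c cF]; rewrite h. Qed.

Lemma same_data_sub m m' F F' p q : (m <= m')%N -> {subset F <= F'} ->
  same_data m' F' p q -> same_data m F p q.
Proof.
move=> mm FF [h1 h2]; split; last by move=> c /FF; exact: h2.
apply/eq_prefix => i im; move/eq_prefix: h1; apply; exact: leq_trans mm.
Qed.

Lemma finite_dataC D : finite_data D -> finite_data (~` D).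
Proof.
move=> [m [F h]]; exists m, F => p q /same_data_sym pq nD Dq; apply: nD; exact: h pq Dq.
Qed.

Lemma finite_dataU D E : finite_data D -> finite_data E -> finite_data (D `|` E).
Proof.
move=> [m [F h]] [m' [F' h']]; exists (maxn m m'), (F ++ F') => p q pq [Dp|Ep].
- left; apply: h Dp; apply: same_data_sub pq; first exact: leq_maxl.
  by move=> c cF; rewrite mem_cat cF.
- right; apply: h' Ep; apply: same_data_sub pq; first exact: leq_maxr.
  by move=> c cF; rewrite mem_cat cF orbT.
Qed.

Definition approximable (E : set Om) := measurable E /\
  forall e : R, 0 < e -> exists D, [/\ measurable D, finite_data D &
    (mu ((E `\` D) `|` (D `\` E)) <= e%:E)%E].

Lemma finite_data_approximable D : measurable D -> finite_data D -> approximable D.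
Proof.
move=> mD fD; split => // e e0; exists D; split => //.
by rewrite setDv setU0 measure0 lee_fin ltW.
Qed.

Lemma approximableC E : approximable E -> approximable (~` E).
Proof.
move=> [mE h]; split; first exact: measurableC.
move=> e /h[D [mD fD De]]; exists (~` D); split.
- exact: measurableC.
- exact: finite_dataC.
- by rewrite !setDE !setCK setUC [~` D `&` _]setIC [~` E `&` _]setIC -!setDE.
Qed.

Lemma approximableU E E' : approximable E -> approximable E' -> approximable (E `|` E').
Proof.
move=> [mE h] [mE' h']; split; first exact: measurableU.
move=> e e0; have e20 : 0 < e / 2 by rewrite divr_gt0.
have [D [mD fD De]] := h _ e20; have [D' [mD' fD' De']] := h' _ e20.
exists (D `|` D'); split; [exact: measurableU|exact: finite_dataU|].
rewrite [e]splitr EFinD; apply: le_trans (leeD De De').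
have mm A B : measurable A -> measurable B -> measurable ((A `\` B) `|` (B `\` A) : set Om).
  by move=> mA mB; apply: measurableU; exact: measurableD.
apply: le_trans (measureU2 mu (mm _ _ mE mD) (mm _ _ mE' mD')).
apply: le_measure; rewrite ?inE.
- by apply: mm; exact: measurableU.
- by apply: measurableU; exact: mm.
move=> p /= [[[Ep|Ep] /not_orP[nD nD']]|[[Dp|Dp] /not_orP[nE nE']]].
- by left; left.
- by right; left.
- by left; right.
- by right; right.
Qed.

(** Half of the error truncates the union to finitely many sets, by continuity from above; the other
    half approximates the finite union. *)
Lemma approximable_bigcup (E : nat -> set Om) :
  (forall n, approximable (E n)) -> approximable (\bigcup_n E n).
Proof.
move=> aE; have mE n : measurable (E n) by case: (aE n).
have mU : measurable (\bigcup_n E n) by exact: bigcupT_measurable.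
split => // e e0; have e20 : 0 < e / 2 by rewrite divr_gt0.
pose F n := \big[setU/set0]_(i < n) E i.
have aF n : approximable (F n).
  rewrite /F; elim: n => [|n IH]; last by rewrite big_ord_recr /=; exact: approximableU.
  by rewrite big_ord0; apply: finite_data_approximable => //; exists 0%N, [::].
have mF n : measurable (F n) by case: (aF n).
have FE n : F n `<=` \bigcup_n E n.
  by rewrite /F -bigcup_mkord; apply: bigcup_sub => i _; exact: bigcup_sup.
have : mu \o (fun n => \bigcup_n E n `\` F n) @ \oo --> mu (\bigcap_n (\bigcup_n E n `\` F n)).
  apply: nonincreasing_cvg_mu.
  - by rewrite -ge0_fin_numE// fin_num_measure//; exact: measurableD.
  - by move=> n; exact: measurableD.
  - by apply: bigcapT_measurable => n; exact: measurableD.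
  - move=> n n' nn; apply/subsetPset; apply: setDS; rewrite /F -!bigcup_mkord.
    by move=> p [i /= ilt Ei]; exists i => //=; exact: leq_trans nn.
rewrite (_ : \bigcap_n _ = set0); last first.
  apply/seteqP; split => // p h; have [[i _ Ei] _] := h 0%N I.
  have [_ ] := h i.+1 I; apply; rewrite /F -bigcup_mkord.
  by exists i => /=.
rewrite measure0 => /fine_cvgP[_] /cvgrPdist_le/(_ _ e20)[n _ /(_ n (leqnn n))] /=.
rewrite sub0r normrN ger0_norm ?fine_ge0// => hn.
have [_ /(_ _ e20)[D [mD fD De]]] := aF n.
exists D; split => //; rewrite [e]splitr EFinD.
have hn' : (mu (\bigcup_n E n `\` F n) <= (e / 2)%:E)%E.
  by rewrite -[leLHS]fineK ?lee_fin// fin_num_measure//; exact: measurableD.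
apply: le_trans (leeD hn' De).
have m1 : measurable (\bigcup_n E n `\` F n) by exact: measurableD.
have m2 : measurable ((F n `\` D) `|` (D `\` F n)) by apply: measurableU; exact: measurableD.
apply: le_trans (measureU2 mu m1 m2).
apply: le_measure; rewrite ?inE.
- by apply: measurableU; exact: measurableD.
- exact: measurableU.
move=> p [[Up nD]|[Dp nU]].
- by case: (pselect (F n p)) => Fp; [right; left|left].
- by right; right; split => // /FE.
Qed.

Lemma sigma_algebra_approximable : sigma_algebra setT approximable.
Proof.
split.
- by apply: finite_data_approximable => //; exists 0%N, [::].
- by move=> A aA; rewrite setTD; exact: approximableC.
- exact: approximable_bigcup.
Qed.

(** The approximable sets form a sigma-algebra, which contains the cylinders of the base and the
    half-lines of the fibre. *)
Lemma measurable_approximable (E : set Om) : measurable E -> approximable E.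
Proof.
move: E; rewrite -[measurable]/(_.-prod.-measurable) measurable_prod_measurableType.
apply: smallest_sub; first exact: sigma_algebra_approximable.
have h1 (A : set Sigma2) : measurable A -> approximable (fst @^-1` A).
  move: A; suff : (measurable : set (set Sigma2)) `<=`
     image_set_system setT (fst : Om -> Sigma2) approximable.
    by move=> h A /h; rewrite /image_set_system /= setTI.
  apply: smallest_sub; first by apply: sigma_algebra_image; exact: sigma_algebra_approximable.
  move=> _ [n [u ->]]; rewrite /image_set_system /= setTI.
  apply: finite_data_approximable.
    by rewrite -[_ @^-1` _]setTI; apply: measurable_fst => //; exact: measurable_cyl.
  by exists n, [::] => p q [e _] /= /cylE h; apply/cylE; rewrite -e.
have h2 (A : set R) : measurable A -> approximable (snd @^-1` A).
  move: A; suff : (measurable : set (set R)) `<=`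
     image_set_system setT (snd : Om -> R) approximable.
    by move=> h A /h; rewrite /image_set_system /= setTI.
  rewrite -[X in X `<=` _]/((@ocitv R).-sigma.-measurable) RGenOInfty.measurableE.
  apply: smallest_sub; first by apply: sigma_algebra_image; exact: sigma_algebra_approximable.
  move=> _ [c ->]; rewrite /image_set_system /= setTI.
  apply: finite_data_approximable.
    by rewrite -[_ @^-1` _]setTI; apply: measurable_snd.
  exists 0%N, [:: c] => p q [_ e] /=; rewrite !in_itv /= !andbT !ltNge => h.
  by rewrite -e ?mem_head.
move=> _ [A mA [B mB <-]].
have -> : A `*` B = ~` (~` (fst @^-1` A) `|` ~` (snd @^-1` B)).
  by rewrite setCU !setCK.
by apply: approximableC; apply: approximableU; apply: approximableC; [exact: h1|exact: h2].
Qed.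

End Approximation.

Lemma measure_bigsetU_le d (T : measurableType d) (R : realType)
    (mu : {measure set T -> \bar R}) (I : Type) (s : seq I) (E : I -> set T) :
  (forall i, measurable (E i)) ->
  (mu (\big[setU/set0]_(i <- s) E i) <= \sum_(i <- s) mu (E i))%E.
Proof.
move=> mE; elim: s => [|i s IH]; first by rewrite !big_nil measure0.
rewrite !big_cons; apply: (le_trans (measureU2 mu (mE i) _)).
  by apply: bigsetU_measurable => k _.
exact: leeD.
Qed.

Lemma measurable_ffun d (T : measurableType d) (I J : finType) (Z : I -> T -> J) :
  (forall i j, measurable (Z i @^-1` [set j])) ->
  forall s : {ffun I -> J}, measurable ((fun p => [ffun i => Z i p]) @^-1` [set s]).
Proof.
move=> mZ s; rewrite (_ : _ @^-1` _ = \bigcap_(i in setT) (Z i @^-1` [set s i])).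
  by apply: fin_bigcap_measurable => // i _; exact: mZ.
apply/seteqP; split => [p /= <- i _ /=|p /= h]; first by rewrite ffunE.
by apply/ffunP => i; rewrite ffunE; exact: h.
Qed.

Lemma measurable_fiber_comp d (T : measurableType d) (I J : finType) (Z : T -> I) (g : I -> J) :
  (forall i, measurable (Z @^-1` [set i])) ->
  forall j, measurable ((g \o Z) @^-1` [set j]).
Proof. by move=> mZ j; rewrite comp_preimage; exact: measurable_finite_preimage. Qed.

(** * Itineraries of the lift *)

Section Lift.
Variables (R : realType) (lam : R).
Hypothesis lam0 : 0 < lam.
Local Notation Om := (Sigma2 * R)%type.
Local Notation Phi := (Phi lam).

Lemma iter_Phi n (p : Om) :
  iter n Phi p = (iter n shift p.1, compS_rev lam (prefix p.1 n) p.2).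
Proof.
elim: n => [|n IH]; first by case: p.
rewrite iterS IH -[in RHS](addn1 n) prefix_iter_shift /Phi; congr pair.
  by rewrite addn1.
by rewrite /compS_rev foldl_cat.
Qed.

Lemma compS_revE s x : compS_rev lam s x = compS lam (rev s) x.
Proof. by rewrite /compS_rev /compS -{1}[s]revK foldl_rev. Qed.

Lemma measurable_Phi : measurable_fun setT Phi.
Proof.
apply: measurable_fun_pair.
  by apply: (measurableT_comp measurable_shift); exact: measurable_fst.
rewrite /Smap; apply: measurable_funD.
  by apply: measurable_funM; [exact: measurable_cst|exact: measurable_snd].
apply: (measurableT_comp (f := fun w : Sigma2 => if w 0%N then 1 else -1 : R)); last exact: measurable_fst.
by apply: (@measurable_fun_prefix _ _ 1) => v w [->].
Qed.

Lemma measurable_iter_Phi n : measurable_fun setT (iter n Phi).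
Proof.
elim: n => [|n IH]; first exact: measurable_id.
exact: (measurableT_comp measurable_Phi IH).
Qed.

Section Rank.
Variables (n m : nat) (F : seq R).

Definition orbit_rank (p : Om) : nat :=
  #|[pred il : 'I_n * 'I_(size F) | F`_(il.2) < (iter il.1 Phi p).2]|.

(** Linear growth in [n] is what makes encoding the rank cost only a logarithm. *)
Lemma orbit_rank_le p : (orbit_rank p <= n * size F)%N.
Proof. by rewrite /orbit_rank (leq_trans (max_card _))// card_prod !card_ord. Qed.

(* For a fixed base word the orbit is increasing in the initial point, so the
   thresholds passed along the orbit form a chain, determined by their number. *)
Lemma same_itinerary (p p' : Om) :
  prefix p.1 (n + m) = prefix p'.1 (n + m) -> orbit_rank p = orbit_rank p' ->
  forall i, (i < n)%N -> same_data m F (iter i Phi p) (iter i Phi p').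
Proof.
wlog pp' : p p' / p.2 <= p'.2.
  move=> h e r i lin; case: (leP p.2 p'.2) => [|/ltW] pp'; first exact: h.
  by apply: same_data_sym; apply: h.
move=> e; have pE i : (i <= n + m)%N -> prefix p.1 i = prefix p'.1 i.
  move=> li; apply/eq_prefix => k ki; move/eq_prefix: e; apply; exact: leq_trans li.
have mono i : (i <= n)%N -> (iter i Phi p).2 <= (iter i Phi p').2.
  move=> li; rewrite !iter_Phi /= pE ?(leq_trans li) ?leq_addr//.
  by rewrite !compS_revE !compSE lerD2l ler_pM2l// exprn_gt0.
move=> r i lin; split.
  rewrite !iter_Phi /=; apply/eq_prefix => k km; rewrite !iter_shift.
  by move/eq_prefix: e; apply; lia.
move=> c /(nthP 0)[l ll <-].
have sub : [pred il : 'I_n * 'I_(size F) | F`_(il.2) < (iter il.1 Phi p).2]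
    \subset [pred il : 'I_n * 'I_(size F) | F`_(il.2) < (iter il.1 Phi p').2].
  apply/fintype.subsetP => -[i' l']; rewrite !inE /= => h.
  by apply: (lt_le_trans h); apply: mono; exact: ltnW.
have /subset_cardP/(_ sub)/(_ (Ordinal lin, Ordinal ll)) := r.
by rewrite !inE /= !leNgt => ->.
Qed.

Lemma measurable_orbit_rank k : measurable (orbit_rank @^-1` [set k]).
Proof.
pose Z (il : 'I_n * 'I_(size F)) (p : Om) : bool := F`_(il.2) < (iter il.1 Phi p).2.
pose g (s : {ffun 'I_n * 'I_(size F) -> bool}) : nat := #|[pred il | s il]|.
have -> : orbit_rank = g \o (fun p => [ffun il => Z il p]).
  apply/funext => p; rewrite /g /orbit_rank /=; apply: eq_card => il.
  by rewrite !inE ffunE.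
rewrite comp_preimage; apply: measurable_finite_preimage; apply: measurable_ffun => il b.
have mZ : measurable_fun setT (Z il).
  apply: measurable_fun_ltr; first exact: measurable_cst.
  by apply: (measurableT_comp measurable_snd); exact: measurable_iter_Phi.
by rewrite -[_ @^-1` _]setTI; exact: mZ.
Qed.

End Rank.

Variable mu : probability Om R.
Hypothesis hinv : invariant mu Phi.

Lemma invariant_iter n (A : set Om) : measurable A -> mu (iter n Phi @^-1` A) = mu A.
Proof.
move=> mA; elim: n => [//|n IH]; rewrite -IH -(hinv (A := iter n Phi @^-1` A)).
  by congr (mu _); apply/seteqP; split => w; rewrite /preimage /= -iterSr.
by rewrite -[_ @^-1` _]setTI; exact: measurable_iter_Phi.
Qed.

Lemma invariant_integral n (g : Om -> R) : measurable_fun setT g -> (forall p, 0 <= g p) ->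
  (\int[mu]_p (g (iter n Phi p))%:E = \int[mu]_p (g p)%:E)%E.
Proof.
move=> mg g0; have mP := measurable_iter_Phi n.
transitivity (\int[pushforward mu (iter n Phi)]_p (g p)%:E)%E.
  rewrite (ge0_integral_pushforward mP)//; first exact/measurable_EFinP.
  by move=> p _; rewrite lee_fin.
apply: (@eq_measure_integral _ _ _ setT _ (pushforward mu (iter n Phi))) => A mA _.
exact: invariant_iter.
Qed.

Section Partition.
Variables (k : nat) (A : 'I_k -> set Om).
Hypothesis hA : is_fin_partition A.

Let mA i : measurable (A i). Proof. by case: hA. Qed.

Definition part_index (p : Om) : 'I_k := let: And3 _ _ h := hA in projT1 (cid (h p)).

Lemma part_indexP p i : A i p <-> part_index p = i.
Proof.
rewrite /part_index; case: hA => _ h2 h3; case: (cid _) => j /= Aj.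
split=> [Ai|<-//]; apply/eqP; apply: contraT => ji.
by have : (A j `&` A i) p by []; rewrite h2.
Qed.

(** The sets [D i] approximating the cells need be neither disjoint nor covering. The label [b] is
    read off from the vector of memberships in the [D i]; outside the union of the symmetric
    differences exactly one membership holds, and it is the right one. *)
Lemma partition_approx (e : R) : 0 < e -> exists (b : Om -> 'I_k) m F,
  [/\ forall p q, same_data m F p q -> b p = b q,
      forall i, measurable (b @^-1` [set i]) &
      (mu [set p | part_index p != b p] <= e%:E)%E].
Proof.
move=> e0; pose i0 : 'I_k := part_index ((fun=> false), 0).
have k0 : (0 < k)%N by case: i0 => j; exact: leq_ltn_trans.
have ek0 : 0 < e / k%:R by rewrite divr_gt0// ltr0n.
have /choice[D hD] : forall i, exists D, [/\ measurable D, finite_data D &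
    (mu ((A i `\` D) `|` (D `\` A i)) <= (e / k%:R)%:E)%E].
  by move=> i; have [_ /(_ _ ek0)] := measurable_approximable mu (mA i).
have mD i : measurable (D i) by case: (hD i).
have /choice[mF hmF] : forall i, exists mF : nat * seq R,
    forall p q, same_data mF.1 mF.2 p q -> D i p -> D i q.
  by move=> i; have [_ [m [F h]] _] := hD i; exists (m, F).
pose Z (i : 'I_k) (p : Om) : bool := `[< D i p >].
have mZ i c : measurable (Z i @^-1` [set c]).
  case: c.
  - rewrite (_ : _ @^-1` _ = D i)//; by apply/seteqP; split => p; rewrite /Z /preimage /=; case: asboolP.
  - rewrite (_ : _ @^-1` _ = ~` D i); first exact: measurableC.
    by apply/seteqP; split => p; rewrite /Z /preimage /=; case: asboolP.
pose v (p : Om) := [ffun i => Z i p].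
pose g (s : {ffun 'I_k -> bool}) : 'I_k := odflt i0 [pick i | s i].
exists (g \o v), (\max_i (mF i).1), (flatten [seq (mF i).2 | i <- enum 'I_k]); split.
- have half p q : same_data (\max_i (mF i).1) (flatten [seq (mF i).2 | i <- enum 'I_k]) p q ->
      forall i, D i p -> D i q.
    move=> pq i; apply: hmF; apply: same_data_sub pq; first exact: leq_bigmax.
    by move=> c cF; apply/flatten_mapP; exists i; rewrite ?mem_enum.
  move=> p q pq /=; congr g; apply/ffunP => i; rewrite !ffunE /Z.
  by apply: asbool_equiv_eq; split; apply: half => //; exact: same_data_sym.
- by apply: measurable_fiber_comp; exact: measurable_ffun.
- pose E i := (A i `\` D i) `|` (D i `\` A i).
  have mE i : measurable (E i) by apply: measurableU; exact: measurableD.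
  apply: (@le_trans _ _ (mu (\big[setU/set0]_(i <- enum 'I_k) E i))).
    apply: le_measure; rewrite ?inE.
    + rewrite (_ : [set p | _] = ~` \bigcup_i (A i `&` (g \o v) @^-1` [set i])).
        apply: measurableC; apply: fin_bigcup_measurable => // i _; apply: measurableI => //.
        by apply: measurable_fiber_comp; exact: measurable_ffun.
      apply/seteqP; split => p /=.
        by move=> /eqP h [i _ [/part_indexP <- /=]] h'; apply: h.
      move=> h; apply/eqP => h'; apply: h; exists (part_index p) => //.
      by split; [apply/part_indexP|].
    + by apply: bigsetU_measurable.
    move=> p /= pb; rewrite -bigcup_seq.
    suff [i Ei] : exists i, E i p by exists i => //=; rewrite mem_enum.
    apply: contrapT => nE; move/negP: pb; apply; apply/eqP.
    have ZE i : Z i p = (part_index p == i).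
      apply/asboolP/eqP => [Di|/part_indexP Ai].
        apply: contrapT => nA; apply: nE; exists i; right; split => // /part_indexP //.
      by apply: contrapT => nD; apply: nE; exists i; left.
    rewrite /g; case: pickP => [i|/(_ (part_index p))]; rewrite ffunE ZE.
      by move/eqP.
    by rewrite eqxx.
  apply: (le_trans (measure_bigsetU_le mu (enum 'I_k) mE)).
  apply: (@le_trans _ _ (\sum_(i <- enum 'I_k) (e / k%:R)%:E)%E).
    by apply: lee_sum => i _; case: (hD i).
  rewrite sumEFin lee_fin big_enum /= sumr_const card_ord -[_ *+ _]mulr_natr.
  by rewrite divfK// pnatr_eq0 -lt0n.
Qed.

End Partition.
End Lift.

(** * Entropy bounded by the cost of coding the base *)

Section JoinEntropy.
Variables (R : realType) (lam : R).
Hypothesis lam0 : 0 < lam.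
Local Notation Om := (Sigma2 * R)%type.
Local Notation Phi := (Phi lam).
Variable mu : probability Om R.
Hypothesis hinv : invariant mu Phi.
Variables (k : nat) (A : 'I_k -> set Om).
Hypothesis hA : is_fin_partition A.

Lemma join_cellE n (t : n.-tuple 'I_k) :
  join_cell Phi A t = (fun p => [tuple part_index hA (iter i Phi p) | i < n]) @^-1` [set t].
Proof.
apply/seteqP; split => [p h|p /= <- i].
  by apply: eq_from_tnth => i; rewrite tnth_mktuple; apply/part_indexP; exact: h.
by rewrite tnth_mktuple; apply/part_indexP.
Qed.

(** The code for an itinerary of length [n] lists the base word in blocks of length [N] weighted by
    [q], then the orbit rank uniformly, which together determine the itinerary of the approximating
    labelling [b], and finally corrects each label. Per step this costs [h0 / N] and three times
    [e / 3]: for the rank, for correct labels and for wrong ones. *)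
Lemma join_entropy_le N (q : N.-tuple bool -> R) (h0 : R) :
  (0 < N)%N -> (forall z, 0 < q z) -> \sum_z q z = 1 ->
  (\int[mu]_p (- ln (q (prefix_tuple p.1 N)))%:E = h0%:E)%E ->
  forall e : R, 0 < e -> exists C, forall n,
    join_entropy mu Phi A n <= n%:R * (h0 / N%:R + e) + C.
Proof.
move=> N0 q0 q1 hq e e0.
have qle z : q z <= 1.
  by rewrite -q1 (bigD1 z) //= lerDl sumr_ge0// => z' _; exact: ltW.
pose i0 : 'I_k := part_index hA ((fun=> false), 0).
have k0 : (0 < k)%N by case: i0 => j; exact: leq_ltn_trans.
have kR : 1 <= k%:R :> R by rewrite ler1n.
have kR0 : 0 < k%:R :> R by rewrite ltr0n.
pose e3 := e / 3; have e30 : 0 < e3 by rewrite divr_gt0.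
(* Chosen so that confirming a correct label costs exactly [- ln (1 - eta) = e3]. *)
pose eta := 1 - expR (- e3).
have eta0 : 0 < eta by rewrite subr_gt0 expR_lt1 oppr_lt0.
have eta1 : eta < 1 by rewrite ltrBlDr ltrDl expR_gt0.
have ek0 : 0 < eta / k%:R by rewrite divr_gt0.
have ek1 : eta / k%:R <= 1 by rewrite ler_pdivrMr// mul1r (le_trans (ltW eta1)).
(* An upper bound for the cost of a wrong label, made positive by the 1; errors of probability at
   most [e3 / L] then cost at most [e3] per step. *)
pose L := 1 - ln (eta / k%:R).
have lek : ln (eta / k%:R) <= 0 by exact: ln_le0.
have L0 : 0 < L by rewrite /L; lra.
have eL0 : 0 < e3 / L by rewrite divr_gt0.
have [b [m [F [hb mb hmu]]]] := partition_approx mu hA eL0.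
(* The slope at which [ln x <= x - 1] is used on [tau * M.+1], turning the logarithmic cost of the
   rank into at most [e3] per step plus a constant. *)
pose tau := e3 / (size F).+1%:R; have tau0 : 0 < tau by rewrite divr_gt0.
exists ((m + 1)%:R * h0 + tau - ln tau) => n.
(* The blocks must cover the first [n + m] letters, since [b] looks [m] letters ahead at each of the
   [n] times; [m + 1] spare blocks suffice because [0 < N]. *)
pose j := (n %/ N + m + 1)%N; pose M := (n * size F)%N.
have jN : (n + m <= j * N)%N.
  rewrite /j !mulnDl mul1n; have h1 := ltn_pmod n N0; have h2 := leq_pmulr m N0.
  by rewrite {1}(divn_eq n N) -!addnA leq_add2l addnC leq_add// ltnW.
pose W (p : Om) : {ffun 'I_j -> N.-tuple bool} :=
  [ffun i : 'I_j => prefix_tuple (iter (i * N) shift p.1) N].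
pose r (p : Om) : 'I_M.+1 := inord (orbit_rank lam n F p).
pose Y p := (W p, r p).
have WE p p' : W p = W p' -> prefix p.1 (n + m) = prefix p'.1 (n + m).
  move=> /ffunP h; apply/eq_prefix => i im.
  have ij : (i %/ N < j)%N by rewrite ltn_divLR// (leq_trans im).
  have := h (Ordinal ij); rewrite !ffunE => /(congr1 val) /= /eq_prefix/(_ (i %% N)%N).
  by rewrite ltn_mod N0 => /(_ isT); rewrite !iter_shift -divn_eq.
(* Base blocks and rank determine the itinerary of [b]; [it] is this decoder, with a dummy value on
   data that do not occur. *)
have /choice[it hit] : forall y, exists s : {ffun 'I_n -> 'I_k},
    forall p, Y p = y -> forall i : 'I_n, s i = b (iter i Phi p).
  move=> y; case: (pselect (exists p, Y p = y)) => [[p0 <-]|nex]; last first.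
    by exists [ffun=> i0] => p Yp; exfalso; apply: nex; exists p.
  exists [ffun i : 'I_n => b (iter i Phi p0)] => p [WW rr] i; rewrite ffunE; apply/esym/hb.
  apply: (same_itinerary lam0 (n := n)) => //; first exact: WE.
  move: rr => /(congr1 val); rewrite /= !inordK ?ltnS ?orbit_rank_le//.
(* The weight of the true label [a] given the predicted label [c]; a total mass of at most 1 over
   [a] is all that a code needs. *)
pose K (a c : 'I_k) : R := if a == c then 1 - eta else eta / k%:R.
have K0 a c : 0 < K a c by rewrite /K; case: ifP => _ //; rewrite subr_gt0.
have K1 c : \sum_a K a c <= 1.
  apply: (@le_trans _ _ (\sum_a ((if a == c then 1 - eta else 0) + eta / k%:R))).
    by apply: ler_sum => a _; rewrite /K; case: ifP => _; rewrite ?lerDl ?lerDr ?add0r// ltW.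
  rewrite big_split /= -big_mkcond big_pred1_eq sumr_const card_ord -[_ *+ _]mulr_natr.
  by rewrite divfK ?gt_eqF// subrK.
pose qq (z : n.-tuple 'I_k * ({ffun 'I_j -> N.-tuple bool} * 'I_M.+1)) : R :=
  (\prod_(i < j) q (z.2.1 i)) * M.+1%:R^-1 * \prod_(i < n) K (tnth z.1 i) (it z.2 i).
have P10 (w : {ffun 'I_j -> N.-tuple bool}) : 0 < \prod_(i < j) q (w i) by exact: prodr_gt0.
have P20 t y : 0 < \prod_(i < n) K (tnth t i) (it y i) by exact: prodr_gt0.
have qq0 z : 0 < qq z by rewrite mulr_gt0// mulr_gt0// invr_gt0.
have qq1 : \sum_z qq z <= 1.
  rewrite (eq_bigr (fun z => qq (z.1, z.2))); last by case.
  rewrite -(pair_big xpredT xpredT (fun t y => qq (t, y))) /= exchange_big /=.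
  apply: (@le_trans _ _ (\sum_(y : {ffun 'I_j -> N.-tuple bool} * 'I_M.+1)
     (\prod_(i < j) q (y.1 i)) * M.+1%:R^-1)).
    apply: ler_sum => y _; rewrite /qq /= -mulr_sumr ler_piMr//.
      by rewrite mulr_ge0 ?invr_ge0// ltW.
    rewrite (sum_tuple_prod (fun i a => K a (it y i))).
    apply: prodr_ile1 => i _; rewrite K1 andbT sumr_ge0// => a _; exact: ltW.
  rewrite -(pair_big xpredT xpredT (fun (w : {ffun 'I_j -> N.-tuple bool}) (s : 'I_M.+1) =>
     (\prod_(i < j) q (w i)) * M.+1%:R^-1)) /=.
  under eq_bigr => w _ do rewrite sumr_const card_ord -[_ *+ _]mulr_natr divfK//.
  rewrite -(bigA_distr_bigA (fun (_ : 'I_j) z => q z)) /=.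
  by rewrite big1// => i _.
pose X (p : Om) := [tuple part_index hA (iter i Phi p) | i < n].
have mA i : measurable (A i) by case: hA.
have mpre n' (S : set Om) : measurable S -> measurable (iter n' Phi @^-1` S).
  by move=> mS; rewrite -[_ @^-1` _]setTI; exact: measurable_iter_Phi.
have mX t : measurable (X @^-1` [set t]).
  rewrite -join_cellE (_ : join_cell _ _ _ =
     \bigcap_(i in setT) (iter (i : 'I_n) Phi @^-1` A (tnth t i))).
    by apply: fin_bigcap_measurable => // i _; exact: mpre.
  by apply/seteqP; split => [p h i _|p h i]; apply: h.
have mW w : measurable (W @^-1` [set w]).
  apply: (@measurable_ffun _ _ _ _ (fun (i : 'I_j) (p : Om) =>
    prefix_tuple (iter (i * N) shift p.1) N)) => i z.
  have -> : (fun p : Om => prefix_tuple (iter (i * N) shift p.1) N) @^-1` [set z] =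
     fst @^-1` (iter (i * N) shift @^-1` ((fun w => prefix_tuple w N) @^-1` [set z])) by [].
  rewrite -[fst @^-1` _]setTI; apply: measurable_fst => //.
  rewrite -[_ @^-1` _]setTI; apply: measurable_iter_shift => //.
  exact: measurable_prefix_tuple.
have mr s : measurable (r @^-1` [set s]).
  rewrite (_ : _ @^-1` _ = orbit_rank lam n F @^-1` [set val s]).
    exact: measurable_orbit_rank.
  apply/seteqP; split => p /=.
    by move=> <-; rewrite /r inordK// ltnS orbit_rank_le.
  by move=> h; apply: val_inj; rewrite /= inordK// ltnS orbit_rank_le.
have mY y : measurable (Y @^-1` [set y]).
  case: y => y1 y2; rewrite (_ : _ @^-1` _ = W @^-1` [set y1] `&` r @^-1` [set y2]).
    exact: measurableI.
  apply/seteqP; split => p; rewrite /preimage /Y /=; first by move=> [<- <-].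
  by move=> [<- <-].
have := entropy_le_code_length mu mX mY qq0 qq1.
have -> : \sum_a - (fine (mu (X @^-1` [set a])) * ln (fine (mu (X @^-1` [set a])))) =
    join_entropy mu Phi A n.
  by apply: eq_bigr => t _; rewrite -join_cellE.
pose hf (p : Om) : R := - ln (q (prefix_tuple p.1 N)).
pose Z (p : Om) : bool := part_index hA p == b p.
pose kf (c : bool) : R := if c then e3 else - ln (eta / k%:R).
have hf0 p : 0 <= hf p by rewrite oppr_ge0 ln_le0.
have mhf : measurable_fun setT hf.
  apply: (measurableT_comp (f := fun w : Sigma2 => - ln (q (prefix_tuple w N)) : R)); last exact: measurable_fst.
  by apply: (@measurable_fun_prefix _ _ N) => v w vw; congr (- ln (q _)); apply: val_inj.
have kf0 c : 0 <= kf c by case: c; rewrite /kf ?oppr_ge0// ltW.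
have mZ c : measurable (Z @^-1` [set c]).
  have mT : measurable (Z @^-1` [set true]).
    rewrite (_ : _ @^-1` _ = \bigcup_i (A i `&` b @^-1` [set i])).
      by apply: fin_bigcup_measurable => // i _; exact: measurableI.
    apply/seteqP; split => p /=.
      by move=> /eqP h; exists (b p) => //; split=> //; apply/(part_indexP hA).
    by move=> [i _ [/(part_indexP hA) h1 h2]]; rewrite /Z h1 (h2 : b p = i) eqxx.
  case: c => //; rewrite (_ : _ @^-1` _ = ~` (Z @^-1` [set true])); first exact: measurableC.
  by apply/seteqP; split => p /=; case: (Z p).
have mkf : measurable_fun setT (fun p => kf (Z p)) := measurable_finite_fun mZ kf.
have codeE p : - ln (qq (X p, Y p)) =
   \sum_(i < j) hf (iter (i * N) Phi p) + ln M.+1%:R + \sum_(i < n) kf (Z (iter i Phi p)).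
  rewrite /qq /= !lnM ?posrE ?mulr_gt0 ?invr_gt0// !opprD lnV ?posrE// opprK.
  congr (_ + _ + _).
    rewrite ln_prod_seq// -sumrN; apply: eq_bigr => i _.
    by rewrite /hf iter_Phi /= ffunE.
  rewrite ln_prod_seq// -sumrN; apply: eq_bigr => i _.
  rewrite tnth_mktuple (hit _ _ erefl) /K /kf /Z; case: ifP => // _.
  by rewrite /eta opprB addrC subrK expRK opprK.
under eq_integral => p _ do rewrite codeE !EFinD.
have mhfi i : measurable_fun setT (fun p => (hf (iter i Phi p))%:E : \bar R).
  apply/measurable_EFinP; apply: (measurableT_comp mhf); exact: measurable_iter_Phi.
have mkfi i : measurable_fun setT (fun p => (kf (Z (iter i Phi p)))%:E : \bar R).
  apply/measurable_EFinP; apply: (measurableT_comp mkf); exact: measurable_iter_Phi.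
have ln0 : 0 <= ln M.+1%:R :> R by rewrite ln_ge0// ler1n.
have fsum (I : Type) (l : seq I) (g : I -> Om -> R) :
    (forall i, measurable_fun setT (fun p => (g i p)%:E : \bar R)) ->
    measurable_fun setT (fun p => (\sum_(i <- l) g i p)%:E : \bar R).
  by move=> h; apply/measurable_EFinP; apply: measurable_sum => i; apply/measurable_EFinP; exact: h.
rewrite ge0_integralD//; last 4 first.
- by move=> p _; apply: adde_ge0; rewrite lee_fin ?sumr_ge0.
- by apply: emeasurable_funD; [exact: fsum|exact: measurable_cst].
- by move=> p _; rewrite lee_fin sumr_ge0.
- exact: fsum.
rewrite ge0_integralD//; last 2 first.
- by move=> p _; rewrite lee_fin sumr_ge0.
- exact: fsum.
rewrite integral_cst// [X in (_ * X)%E](probability_setT mu) mule1.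
have intsum (g : Om -> R) (c : R) l (e' : 'I_l -> nat) :
    measurable_fun setT g -> (forall p, 0 <= g p) -> (\int[mu]_p (g p)%:E <= c%:E)%E ->
    (\int[mu]_p (\sum_(i < l) g (iter (e' i) Phi p))%:E <= (l%:R * c)%:E)%E.
  move=> mg g0 gc; under eq_integral => p _ do rewrite -sumEFin.
  rewrite ge0_integral_sum//; last 2 first.
  - move=> i; apply/measurable_EFinP; apply: (measurableT_comp mg).
    exact: measurable_iter_Phi.
  - by move=> i p _; rewrite lee_fin.
  apply: (@le_trans _ _ (\sum_(i < l) c%:E)%E).
    by apply: lee_sum => i _; rewrite invariant_integral.
  by rewrite sumEFin lee_fin sumr_const card_ord mulr_natl.
have I1 := intsum hf h0 j (fun i => (i * N)%N) mhf hf0.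
rewrite hq lexx in I1; have {}I1 := I1 isT.
have kfle : (\int[mu]_p (kf (Z p))%:E <= (2 * e3)%:E)%E.
  rewrite (finite_integral mZ)// big_bool /= (_ : 2 * e3 = e3 + e3); last by ring.
  rewrite EFinD.
  apply: leeD.
    rewrite -[leRHS]mule1; apply: lee_pmul => //; rewrite ?lee_fin ?(ltW e30)//.
    exact: probability_le1.
  apply: (@le_trans _ _ (L%:E * (e3 / L)%:E)%E); last first.
    by rewrite -EFinM lee_fin mulrCA mulfV ?gt_eqF// mulr1.
  apply: lee_pmul => //; rewrite ?lee_fin ?oppr_ge0//.
    by rewrite /kf /L; lra.
  apply: le_trans hmu; rewrite (_ : Z @^-1` _ = [set p | part_index hA p != b p])//.
  by apply/seteqP; split => p; rewrite /Z /preimage /=; case: eqP.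
have I2 := intsum _ _ n (fun i => nat_of_ord i) mkf (fun p => kf0 (Z p)) kfle.
move=> H; have {H I1 I2} := le_trans H (leeD (leeD I1 (lexx _)) I2).
rewrite -!EFinD lee_fin => H; apply: (le_trans H).
have h00 : 0 <= h0.
  by rewrite -lee_fin -hq; apply: integral_ge0 => p _; rewrite lee_fin; exact: (hf0 p).
have jle : j%:R <= n%:R / N%:R + (m + 1)%:R :> R.
  rewrite /j -addnA natrD lerD2r ler_pdivlMr ?ltr0n// -natrM ler_nat.
  exact: leq_trunc_div.
have H1 : j%:R * h0 <= n%:R * (h0 / N%:R) + (m + 1)%:R * h0.
  by rewrite mulrA mulrAC -mulrDl ler_wpM2r.
have H2 : ln M.+1%:R <= n%:R * e3 + tau - ln tau.
  have := @ln_le_sub1 R (tau * M.+1%:R); rewrite mulr_gt0// => /(_ isT).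
  rewrite lnM ?posrE// -natr1 mulrDr mulr1 /M natrM.
  have : tau * (n%:R * (size F)%:R) <= n%:R * e3.
    rewrite mulrCA ler_wpM2l// /tau mulrAC ler_pdivrMr//.
    by rewrite ler_wpM2l ?ltW// ltr_nat.
  by lra.
have : n%:R * e = n%:R * e3 * 3 by rewrite /e3; field.
by rewrite mulrDr; lra.
Qed.

End JoinEntropy.

(** * A biased base has entropy below [ln 2] *)

Lemma ln1D_ge (R : realType) (x : R) : - 2^-1 <= x -> x - 2 * x ^+ 2 <= ln (1 + x).
Proof.
move=> hx; have x0 : 0 < 1 + x by lra.
have := @ln_le_sub1 R (1 + x)^-1; rewrite invr_gt0 x0 => /(_ isT).
rewrite lnV ?posrE// => h.
suff : x - 2 * x ^+ 2 <= 1 - (1 + x)^-1 by lra.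
have -> : 1 - (1 + x)^-1 = x / (1 + x) by field; rewrite gt_eqF.
rewrite ler_pdivlMr// -subr_ge0.
have -> : x - (x - 2 * x ^+ 2) * (1 + x) = x ^+ 2 * (1 + 2 * x) by ring.
by rewrite mulr_ge0 ?sqr_ge0//; lra.
Qed.

Lemma part_entropy_le d (T : measurableType d) (R : realType) (mu : set T -> \bar R)
    (f : T -> T) k (A : 'I_k -> set T) (B C : R) : 0 <= B ->
  (forall n, join_entropy mu f A n <= n%:R * B + C) -> part_entropy mu f A <= B.
Proof.
move=> B0 h; rewrite /part_entropy.
set u := (fun n : nat => _).
(* A divergent sequence has the default limit 0, which [0 <= B] covers, so convergence of the
   averages need not be proved. *)
case: (pselect (cvg (u @ \oo))) => [cu|/dvgP ->//].
apply/ler_addgt0Pr => e e0.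
apply: (@limr_le _ _ _ _ _ u) => //; near=> n.
have n0 : (0 < n)%N by near: n; exact: nbhs_infty_gt.
have hn : `|C| / e <= n%:R by near: n; exact: nbhs_infty_ger.
rewrite ler_pdivrMr// in hn.
rewrite /u mulrC ler_pdivrMr ?ltr0n//; apply: (le_trans (h n)).
by have := ler_norm C; rewrite mulrDl ![_ * n%:R]mulrC; lra.
Unshelve. all: by end_near. Qed.

Section Marginal.
Variables (R : realType) (lam : R).
Hypothesis lam0 : 0 < lam.
Local Notation Om := (Sigma2 * R)%type.
Local Notation Phi := (Phi lam).

(** The uniform weights [a = 2 ^- N] are tilted towards the word [u], or away from it, by the factor
    [1 + s (1_u - a)], which preserves the total mass. To first order the expected code length drops
    by [s (pu - a) = 4 s ^ 2], and the second-order loss is at most [2 s ^ 2]. *)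
Lemma biased_code (mu : probability Om R) N (u : N.-tuple bool) :
  mu (fst @^-1` cyl N (ext u)) <> ((2 : R) ^- N)%:E ->
  exists (q : N.-tuple bool -> R) (h0 : R),
    [/\ forall z, 0 < q z, \sum_z q z = 1,
        (\int[mu]_p (- ln (q (prefix_tuple p.1 N)))%:E = h0%:E)%E & h0 < N%:R * ln 2].
Proof.
pose a : R := 2 ^- N; rewrite -/a => hne.
have a0 : 0 < a by rewrite invr_gt0 exprn_gt0.
have a1 : a <= 1 by rewrite invf_le1 ?exprn_gt0// exprn_ege1// ler1n.
pose Z (p : Om) := prefix_tuple p.1 N == u.
have ZE : Z @^-1` [set true] = fst @^-1` cyl N (ext u).
  apply/seteqP; split => p; rewrite /Z /preimage /=.
    by move=> /eqP h; apply/cyl_ext.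
  by move/cyl_ext => ->; rewrite eqxx.
have mZ c : measurable (Z @^-1` [set c]).
  have mT : measurable (Z @^-1` [set true]).
    rewrite ZE -[_ @^-1` _]setTI; apply: measurable_fst => //; exact: measurable_cyl.
  case: c => //; rewrite (_ : _ @^-1` _ = ~` (Z @^-1` [set true])); first exact: measurableC.
  by apply/seteqP; split => p; rewrite /preimage /=; case: (Z p).
pose pu := fine (mu (Z @^-1` [set true])).
have puE : mu (Z @^-1` [set true]) = pu%:E by rewrite fineK// fin_num_measure.
have pfE : mu (Z @^-1` [set false]) = (1 - pu)%:E.
  rewrite (_ : _ @^-1` _ = ~` (Z @^-1` [set true])).
    by rewrite probability_setC// puE.
  by apply/seteqP; split => p; rewrite /preimage /=; case: (Z p).
have pu0 : 0 <= pu by rewrite fine_ge0.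
have pu1 : pu <= 1 by rewrite -lee_fin -puE; exact: probability_le1.
have {hne} hne : pu - a != 0.
  by apply/eqP => h; apply: hne; rewrite -ZE puE; congr EFin; lra.
(* The 4 keeps [x] within [[-1/4, 1/4]], where the quadratic lower bound for the logarithm applies,
   and lets the gain exceed the loss. *)
pose s := (pu - a) / 4.
have sE : pu - a = 4 * s by rewrite /s; field.
have s1 : s <= 4^-1 by rewrite /s; lra.
have s2 : - 4^-1 <= s by rewrite /s; lra.
have ss : 0 < s ^+ 2 by rewrite exprn_even_gt0//= /s mulf_neq0.
pose x (c : bool) : R := s * (c%:R - a).
have ca (c : bool) : `|c%:R - a| <= 1.
  by rewrite ler_norml; apply/andP; case: c; rewrite ?mulr1n ?mulr0n; split; lra.
have xs c : x c ^+ 2 <= s ^+ 2.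
  rewrite /x exprMn ler_piMr ?sqr_ge0// -[leRHS](expr1n _ 2) -ler_sqrt.
    by rewrite !sqrtr_sqr normr1.
  by rewrite expr1n.
have xl c : - 4^-1 <= x c /\ x c <= 4^-1.
  have : `|x c| <= `|s| * 1.
    by rewrite normrM ler_wpM2l.
  have : `|s| <= 4^-1 by rewrite ler_norml s2 s1.
  by move=> h1 h2; move: (le_trans h2 (ler_pM (normr_ge0 _) ler01 h1 (lexx 1))); rewrite mulr1 ler_norml => /andP[].
pose f (c : bool) : R := a * (1 + x c).
have f0 c : 0 < f c by rewrite mulr_gt0//; have := xl c; lra.
pose q (z : N.-tuple bool) := f (z == u).
have q1 : \sum_z q z = 1.
  have e1 : \sum_(z : N.-tuple bool) 1 = 2 ^+ N :> R by rewrite sumr_const; exact: card_words.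
  have e2 : \sum_(z : N.-tuple bool) a = 1.
    under eq_bigr do rewrite -[a]mul1r.
    by rewrite -mulr_suml e1 /a mulfV// expf_neq0.
  have e3 : \sum_(z : N.-tuple bool) (z == u)%:R = 1 :> R.
    by rewrite (bigD1 u) //= eqxx big1 ?addr0 => [|z /negbTE ->//].
  rewrite /q /f -mulr_sumr big_split /= -mulr_sumr sumrB e1 e2 e3 subrr mulr0 addr0.
  by rewrite /a mulVf// expf_neq0.
have qle z : q z <= 1.
  by rewrite -q1 (bigD1 z) //= lerDl sumr_ge0// => z' _; exact: (ltW (f0 _)).
pose g c := - ln (f c).
have lf c : ln (f c) = ln (1 + x c) - N%:R * ln 2.
  rewrite /f lnM ?posrE//; last by have := xl c; lra.
  by rewrite /a lnV ?posrE ?exprn_gt0// lnXn// mulr_natl addrC.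
exists q, (g true * pu + g false * (1 - pu)); split => //.
- by move=> z; exact: f0.
(* The value [g false] is known to be nonnegative only if some word differs from [u]. Truncation at
   0 provides the sign needed for integration and changes nothing, since otherwise its weight
   [1 - pu] vanishes. *)
- rewrite (eq_integral (fun p => (Num.max 0 (g (Z p)))%:E)); last first.
    move=> p _; congr EFin; rewrite /q -/(Z p) -/(g (Z p)) max_r// oppr_ge0.
    exact: ln_le0 (qle _).
  rewrite (@finite_integral _ _ _ _ Z mZ mu (fun c => Num.max 0 (g c))); last first.
    by move=> c; rewrite le_max lexx.
  rewrite big_bool /= [X in (_ * X + _)%E]puE [X in (_ + _ * X)%E]pfE -!EFinM -EFinD.
  congr EFin; congr (_ + _).
    by rewrite max_r// /g oppr_ge0; have := ln_le0 (qle u); rewrite /q eqxx.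
  case: (eqVneq pu 1) => [->|pn1]; first by rewrite subrr !mulr0.
  rewrite max_r// /g oppr_ge0.
  have [z zu] : exists z, z != u.
    apply: contrapT => nz; case/eqP: pn1.
    suff : Z @^-1` [set true] = setT by move=> h; apply: EFin_inj; rewrite -puE h probability_setT.
    apply/seteqP; split => // p _; rewrite /preimage /= /Z; apply: contrapT => h.
    by apply: nz; exists (prefix_tuple p.1 N); apply/negP => /h.
  by have := ln_le0 (qle z); rewrite /q (negbTE zu).
- rewrite /g !lf; have h1 := @ln1D_ge R (x true); have h2 := @ln1D_ge R (x false).
  have {}h1 := h1 (le_trans _ (xl true).1); have {}h2 := h2 (le_trans _ (xl false).1).
  have {}h1 : x true - 2 * s ^+ 2 <= ln (1 + x true).
    by apply: le_trans (h1 _); [rewrite lerD2l lerN2 ler_pM2l|lra].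
  have {}h2 : x false - 2 * s ^+ 2 <= ln (1 + x false).
    by apply: le_trans (h2 _); [rewrite lerD2l lerN2 ler_pM2l|lra].
  have k1 := ler_wpM2l pu0 h1.
  have k2 := ler_wpM2l (_ : 0 <= 1 - pu) h2; rewrite subr_ge0 in k2; have {}k2 := k2 pu1.
  have e1 : pu * (x true - 2 * s ^+ 2) + (1 - pu) * (x false - 2 * s ^+ 2) =
     s * (pu - a) - 2 * s ^+ 2 by rewrite /x /=; ring.
  have e2 : s * (pu - a) = 4 * s ^+ 2 by rewrite sE; ring.
  have e3 : - (ln (1 + x true) - N%:R * ln 2) * pu + - (ln (1 + x false) - N%:R * ln 2) * (1 - pu)
     = N%:R * ln 2 - (pu * ln (1 + x true) + (1 - pu) * ln (1 + x false)) by ring.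
  by rewrite e3; lra.
Qed.

Lemma full_entropy_marginal (mu : probability Om R) : invariant mu Phi ->
  ((ln 2)%:E <= ks_entropy mu Phi)%E ->
  forall N u, mu (fst @^-1` cyl N u) = ((2 : R) ^- N)%:E.
Proof.
move=> inv ks N u; apply: contrapT => hne.
have uE : cyl N u = cyl N (ext (prefix_tuple u N)).
  by apply/seteqP; split => w /cylE h; apply/cylE; rewrite ?prefix_ext// in h *.
rewrite uE in hne.
have N0 : (0 < N)%N.
  rewrite lt0n; apply/eqP => N0; apply: hne.
  rewrite (_ : fst @^-1` _ = setT) ?probability_setT ?N0 ?expr0 ?invr1//.
  by apply/seteqP; split => // p _; rewrite /preimage /= => i; rewrite N0.
have NR : 0 < N%:R :> R by rewrite ltr0n.
have [q [h0 [q0 q1 hq hlt]]] := biased_code hne.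
have h00 : 0 <= h0.
  rewrite -lee_fin -hq; apply: integral_ge0 => p _; rewrite lee_fin oppr_ge0 ln_le0//.
  by rewrite -q1 (bigD1 (prefix_tuple p.1 N)) //= lerDl sumr_ge0// => z' _; exact: ltW.
have hN : h0 / N%:R < ln 2 by rewrite ltr_pdivrMr// mulrC.
pose e := (ln 2 - h0 / N%:R) / 2.
have e0 : 0 < e by rewrite divr_gt0// subr_gt0.
have : (ks_entropy mu Phi <= (h0 / N%:R + e)%:E)%E.
  apply: ge_ereal_sup => _ [k [A [hA ->]]]; rewrite lee_fin.
  have [C hC] := join_entropy_le lam0 inv hA N0 q0 q1 hq e0.
  apply: (part_entropy_le _ hC).
  by rewrite addr_ge0 ?(ltW e0)// divr_ge0// ltW.
move=> /(le_trans ks); rewrite lee_fin /e; lra.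
Qed.

End Marginal.

(** * Identification of the marginals *)

(** Distribution functions are continuous from the right, so comparisons up to every [e > 0] become
    exact. *)
Lemma measure_right_continuous d (T : measurableType d) (R : realType) (m : probability T R)
    (X : T -> R) (c : R) (r : \bar R) :
  (forall q, measurable [set t | X t <= q]) ->
  (forall e, 0 < e -> (r <= m [set t | (X t <= c + e)%R])%E) ->
  (r <= m [set t | (X t <= c)%R])%E.
Proof.
move=> mX h; pose F n := [set t | X t <= c + n.+1%:R^-1].
have FE : \bigcap_n F n = [set t | X t <= c].
  apply/seteqP; split => t /=.
    move=> Ft; apply/ler_addgt0Pr => e e0.
    have hn := truncnS_gt (e^-1); apply: (le_trans (Ft (Num.truncn e^-1) I)).
    rewrite lerD2l -[leRHS]invrK ler_pV2 ?inE ?unitfE ?invr_gt0 ?invr_eq0 ?gt_eqF ?ltr0n//.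
    exact: ltW.
  by move=> Xt n _; apply: (le_trans Xt); rewrite lerDl invr_ge0.
have : m \o F @ \oo --> m (\bigcap_n F n).
  apply: nonincreasing_cvg_mu.
  - by apply: le_lt_trans (ltry 1); apply: probability_le1; exact: mX.
  - by move=> n; exact: mX.
  - by rewrite FE; exact: mX.
  - move=> n k nk; apply/subsetPset => t /= h'; apply: (le_trans h').
    by rewrite lerD2l lef_pV2 ?posrE ?ltr0n// ler_nat ltnS.
rewrite FE => cv; rewrite -(cvg_lim _ cv)//; apply: lime_ge.
  by apply/cvg_ex; eexists; exact: cv.
by apply: nearW => n; apply: h; rewrite invr_gt0.
Qed.

Section BernoulliLift.
Variables (R : realType) (lam : R).
Hypotheses (lam0 : 0 < lam) (lam1 : lam < 1).
Local Notation Om := (Sigma2 * R)%type.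
Local Notation Phi := (Phi lam).
Local Notation ell := (ell lam).
Local Notation pt := (pt lam).
Local Notation coding := (coding lam).
Variable P : probability Sigma2 R.
Hypothesis hP : is_uniform_bernoulli P.

Let mcoding : measurable_fun setT (coding : Sigma2 -> R).
Proof. exact: measurable_coding. Qed.

Let mcodingX (B : set R) : measurable B -> measurable (coding @^-1` B : set Sigma2).
Proof. by move=> mB; rewrite -[_ @^-1` _]setTI; exact: mcoding. Qed.

Lemma measurable_Smap b : measurable_fun setT (Smap lam b).
Proof.
by apply: measurable_funD; [apply: measurable_funM|]; [exact: measurable_cst|exact: measurable_id|exact: measurable_cst].
Qed.

Let mSmapX b (B : set R) : measurable B -> measurable (Smap lam b @^-1` B).
Proof. by move=> mB; rewrite -[_ @^-1` _]setTI; exact: measurable_Smap. Qed.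

(** Conditioning on the first letter. With [D b] the event that [Smap lam b (coding w)] lies in [B],
    this is the self-similarity of the Bernoulli convolution. *)
Lemma cyl1_partition (D : bool -> set Sigma2) :
  (forall b, measurable (D b)) ->
  P [set w | (iter 1 shift @^-1` D (w 0%N)) w] =
  (2^-1%:E * (P (D true) + P (D false)))%E.
Proof.
move=> mD.
have -> : [set w | (iter 1 shift @^-1` D (w 0%N)) w] =
    (cyl 1 (fun=> true) `&` iter 1 shift @^-1` D true) `|`
    (cyl 1 (fun=> false) `&` iter 1 shift @^-1` D false).
  apply/seteqP; split => w /=.
    case e : (w 0%N) => h; [left|right]; (split; last exact: h) => i;
    by rewrite ltnS leqn0 => /eqP ->.
  by move=> [|] [/(_ 0%N isT) -> h].
have mit b : measurable (iter 1 shift @^-1` D b : set Sigma2).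
  by rewrite -[_ @^-1` _]setTI; exact: measurable_iter_shift.
rewrite measureU; last 3 first.
- by apply: measurableI => //; exact: measurable_cyl.
- by apply: measurableI => //; exact: measurable_cyl.
- by apply/seteqP; split => // w [[h1 _] [h2 _]]; have := h1 0%N isT; rewrite h2.
have h0 := bernoulli_indep hP 1 (fun=> true) (mD true).
have h1 := bernoulli_indep hP 1 (fun=> false) (mD false).
rewrite expr1 in h0 h1; rewrite ge0_muleDr//.
by congr (_ + _)%E; [exact: h0|exact: h1].
Qed.

(** The product of the Bernoulli measure and the Bernoulli convolution: the preimage of a rectangle
    splits according to the first letter, and self-similarity of the convolution gives invariance.
    It serves as a competitor whose entropy bounds the maximal one from below. *)
Lemma lifted_measure : exists nu : probability Om R,
  [/\ invariant nu Phi, nu (setT `*` Ilam lam) = 1%E &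
      forall n u, nu (fst @^-1` cyl n u) = ((2 : R) ^- n)%:E].
Proof.
pose X : {mfun Sigma2 >-> R} := mfun_Sub (mem_set mcoding).
pose Q : probability R R := distribution P X.
have QE B : Q B = P (coding @^-1` B) by [].
pose nu : probability Om R := (P \x Q)%E.
have nuE (A : set Sigma2) (B : set R) : measurable A -> measurable B -> nu (A `*` B) = (P A * Q B)%E.
  by move=> mA mB; exact: product_measure1E.
exists nu; split.
- move=> E mE; apply/esym.
  pose m' : {measure set Om -> \bar R} := pushforward nu Phi.
  apply: (@product_measure_unique _ _ Sigma2 R R P Q (m' (measurable_Phi lam))) mE => A B mA mB.
  rewrite /m' /= /pushforward.
  pose C b := cyl 1 (fun=> b) `&` iter 1 shift @^-1` A.
  have mC b : measurable (C b : set Sigma2).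
    apply: measurableI; first exact: measurable_cyl.
    by rewrite -[_ @^-1` _]setTI; exact: measurable_iter_shift.
  have PC b : P (C b) = (2^-1%:E * P A)%E.
    by have := bernoulli_indep hP 1 (fun=> b) mA; rewrite expr1.
  have -> : Phi @^-1` (A `*` B) = (C true `*` (Smap lam true @^-1` B)) `|`
      (C false `*` (Smap lam false @^-1` B)).
    apply/seteqP; split => [[w x] /=|[w x]].
      rewrite /Phi /= => -[Aw Bx]; case e : (w 0%N) Bx => Bx; [left|right];
      split => //=; split => // i; by rewrite ltnS leqn0 => /eqP ->.
    move=> [] [[h1 h2] h3]; have e : w 0%N = _ := h1 0%N isT.
      by split => //; rewrite /Phi /= e.
    by split => //; rewrite /Phi /= e.
  rewrite measureU; last 3 first.
  - by apply: measurableX => //; exact: mSmapX.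
  - by apply: measurableX => //; exact: mSmapX.
  - by apply/seteqP; split => // -[w x] [[[h1 _] _] [[h2 _] _]]; have := h1 0%N isT; rewrite h2.
  have QB : Q B = (2^-1%:E * (Q (Smap lam true @^-1` B) + Q (Smap lam false @^-1` B)))%E.
    have h := @cyl1_partition (fun b => coding @^-1` (Smap lam b @^-1` B))
      (fun b => mcodingX (mSmapX b mB)).
    apply: etrans h; rewrite QE; congr (P _); apply/seteqP.
    by split => w; rewrite /preimage /= (coding_shift lam0 lam1 w).
  have h20 c : (0 <= 2^-1%:E * Q (Smap lam c @^-1` B))%E by rewrite mule_ge0// lee_fin.
  rewrite QB ge0_muleDr// (ge0_muleDr _ (h20 true) (h20 false)).
  congr (_ + _)%E; apply: (etrans (nuE _ _ (mC _) (mSmapX _ mB))); by rewrite PC muleCA muleA.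
- have mI : measurable (Ilam lam) by exact: measurable_itv.
  transitivity (P setT * Q (Ilam lam))%E; first by rewrite -nuE.
  rewrite QE probability_setT mul1e.
  rewrite (_ : _ @^-1` _ = setT) ?probability_setT//.
  apply/seteqP; split => // w _; rewrite /preimage /= /Ilam /= in_itv /=.
  by have := coding_bound lam0 lam1 w; rewrite ler_norml.
- move=> n u; have := nuE _ _ (measurable_cyl n u) measurableT.
  rewrite -(hP n u) probability_setT mule1 => <-; congr (nu _).
  by apply/seteqP; split => // p [].
Qed.

(** The partition by the first letter has cylinders of equal mass as joins, so its join entropy is
    exactly [n ln 2]. *)
Lemma ks_entropy_ge (nu : probability Om R) :
  (forall n u, nu (fst @^-1` cyl n u) = ((2 : R) ^- n)%:E) ->
  ((ln 2)%:E <= ks_entropy nu Phi)%E.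
Proof.
move=> h; pose A (i : 'I_2) : set Om := [set p | p.1 0%N = (0 < i)%N].
have mA i : measurable (A i).
  rewrite (_ : A i = fst @^-1` [set w : Sigma2 | w 0%N = (0 < i)%N]) //.
  rewrite -[_ @^-1` _]setTI; apply: measurable_fst => //.
  by apply: (@measurable_prefix_set 1) => v w /= [<-].
apply: ereal_sup_ubound; exists 2%N, A; split.
  split => //.
    move=> i j ij; apply/seteqP; split => // p [h1 h2]; case/negP: ij; apply/eqP/val_inj.
    have : (0 < i)%N = (0 < j)%N by rewrite -(h1 : _ = _) -(h2 : _ = _).
    by case: i {h1} => [[|[|//]] ?]; case: j {h2} => [[|[|//]] ?].
  by move=> p; case e : (p.1 0%N); [exists (Ordinal (isT : 1 < 2)%N)|exists ord0].
congr EFin; apply/esym.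
have jE n : join_entropy nu Phi A n = n%:R * ln 2.
  rewrite /join_entropy (eq_bigr (fun=> 2 ^- n * (n%:R * ln 2))).
    rewrite sumr_const card_tuple card_ord -[_ *+ _]mulr_natl natrX mulVKf//.
  move=> t _; rewrite (_ : join_cell Phi A t =
      fst @^-1` cyl n (fun i => nth false [seq (0 < val i)%N | i <- t] i)).
    rewrite h /= lnV ?posrE ?exprn_gt0// lnXn// mulr_natl mulrN opprK//.
  have tE (i : 'I_n) : nth false [seq (0 < val i)%N | i <- t] i = (0 < tnth t i)%N.
    by rewrite (nth_map (tnth t i)) ?size_tuple// -tnth_nth.
  apply/seteqP; split => p hp.
    move=> i lin; have := hp (Ordinal lin); rewrite /A /= iter_Phi /= iter_shift addn0 => ->.
    by rewrite -tE.
  by move=> i; rewrite /A /= iter_Phi /= iter_shift addn0 -tE; exact: hp.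
apply/cvg_lim => //; apply/cvgrPdist_le => e e0; near=> n.
have n0 : (0 < n)%N by near: n; exact: nbhs_infty_gt.
by rewrite jE mulKf ?pnatr_eq0 -?lt0n// subrr normr0 ltW.
Unshelve. all: by end_near. Qed.

Section SecondMarginal.
Variable mu : probability Om R.
Hypotheses (inv : invariant mu Phi) (full : mu (setT `*` Ilam lam) = 1%E)
  (marg : forall n u, mu (fst @^-1` cyl n u) = ((2 : R) ^- n)%:E).

Lemma first_marginal (E : set Sigma2) : measurable E -> mu (fst @^-1` E) = P E.
Proof.
pose m1 : {measure set Sigma2 -> \bar R} := pushforward mu fst.
have mfst : measurable_fun [set: Om] fst by exact: measurable_fst.
move: E; apply: (@Sigma2_measure_unique R (m1 mfst) P) => [|n u].
- by rewrite /m1 /= /pushforward preimage_setT [X in (X < _)%E](probability_setT mu) ltry.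
- exact: (etrans (marg n u) (esym (hP n u))).
Qed.

Lemma bernoulli_prefix_set n (q : pred (n.-tuple bool)) :
  P [set w | q (prefix_tuple w n)] = ((2 ^+ n)^-1 * \sum_z (q z)%:R)%:E.
Proof.
rewrite -(prefix_integral_bernoulli hP)//.
have mq : measurable [set w : Sigma2 | q (prefix_tuple w n)].
  by apply: (@measurable_prefix_set n) => v w vw /=; rewrite (_ : prefix_tuple v n = prefix_tuple w n)//; exact: val_inj.
rewrite -[X in P X]setIT -(integral_indic P measurableT mq).
apply: eq_integral => w _; rewrite indicE; congr ((nat_of_bool _)%:R%:E).
by apply/idP/idP; rewrite inE.
Qed.

(** The lift applies the newest letter outermost, the coding map the oldest; reversing words
    reconciles the two since all words of length [n] are equally likely. *)
Lemma pt_rev_law n (c : R) :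
  P [set w | pt (rev (prefix w n)) <= c] = P [set w | pt (prefix w n) <= c].
Proof.
have h1 := bernoulli_prefix_set (fun z : n.-tuple bool => pt (rev z) <= c).
have h2 := bernoulli_prefix_set (fun z : n.-tuple bool => pt z <= c).
apply: (etrans h1); apply: etrans (esym h2); congr (_ * _)%:E.
rewrite [RHS](reindex_inj (h := fun z : n.-tuple bool => [tuple of rev z])) //.
by move=> x y /(congr1 val) /= /(can_inj revK) /val_inj.
Qed.

Let F c := mu [set p | p.2 <= c].
Let G c := P [set w | coding w <= c].

Let mle c : measurable [set p : Om | p.2 <= c].
Proof.
rewrite (_ : [set _ | _] = snd @^-1` `]-oo, c]).
  by rewrite -[_ @^-1` _]setTI; apply: measurable_snd.
by apply/seteqP; split => p; rewrite /= in_itv.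
Qed.

Let mcle c : measurable [set w : Sigma2 | coding w <= c].
Proof.
rewrite (_ : [set _ | _] = coding @^-1` `]-oo, c]); first exact: mcodingX.
by apply/seteqP; split => p; rewrite /= in_itv.
Qed.

(** After [n] steps the fibre coordinate has forgotten its start up to [lam ^+ n * ell] and is close
    to [pt] of the reversed prefix. This has the law of [pt] of the prefix, which in turn is close
    to the coding map. Each approximation uses half of [e]. *)
Lemma law_compare (c e : R) : 0 < e -> (F c <= G (c + e)%R)%E /\ (G c <= F (c + e)%R)%E.
Proof.
move=> e0; have e20 : 0 < e / 2 by rewrite divr_gt0.
have [n _ /(_ n (leqnn n)) /= hn] := geo_ell_small lam0 lam1 e20.
have ms (q : R) : measurable [set w : Sigma2 | pt (rev (prefix w n)) <= q].
  by apply: (@measurable_prefix_set n) => v w /= ->.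
have ms' (q : R) : measurable [set w : Sigma2 | pt (prefix w n) <= q].
  by apply: (@measurable_prefix_set n) => v w /= ->.
have mit q : measurable (iter n Phi @^-1` [set p : Om | p.2 <= q]).
  by rewrite -[_ @^-1` _]setTI; apply: measurable_iter_Phi.
have mf q : measurable (fst @^-1` [set w : Sigma2 | pt (rev (prefix w n)) <= q] : set Om).
  by rewrite -[_ @^-1` _]setTI; apply: measurable_fst.
have mI : measurable (setT `*` Ilam lam : set Om) by apply: measurableX => //; exact: measurable_itv.
have H q : mu (fst @^-1` [set w : Sigma2 | pt (rev (prefix w n)) <= q]) =
    P [set w | pt (prefix w n) <= q] by rewrite first_marginal// pt_rev_law.
have near_pt (p : Om) : (setT `*` Ilam lam) p ->
    `|(iter n Phi p).2 - pt (rev (prefix p.1 n))| <= lam ^+ n * ell.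
  move=> [_]; rewrite /Ilam /= in_itv /= => hp.
  rewrite iter_Phi /= compS_revE compSE size_rev size_prefix_word addrC addKr.
  by rewrite normrM gtr0_norm ?exprn_gt0// ler_pM2l ?exprn_gt0// ler_norml.
have le_full (A B : set Om) : measurable A -> measurable B ->
    A `&` (setT `*` Ilam lam) `<=` B -> (mu A <= mu B)%E.
  move=> mA mB AB; have n0 : mu (~` (setT `*` Ilam lam)) = 0%E.
    by rewrite probability_setC// full subee.
  apply: (@le_trans _ _ (mu (B `|` ~` (setT `*` Ilam lam)))).
    apply: le_measure; rewrite ?inE//; first by apply: measurableU => //; exact: measurableC.
    by move=> p Ap; case: (pselect ((setT `*` Ilam lam) p)) => Ip; [left; apply: AB|right].
  apply: (le_trans (measureU2 mu mB (measurableC mI))).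
  by rewrite [X in (_ + X)%E]n0 adde0.
split.
- apply: (@le_trans _ _ (P [set w | pt (prefix w n) <= c + e / 2])).
    rewrite /F -(invariant_iter inv n (mle c)) -H; apply: le_full => //.
    move=> p [/= h /near_pt]; rewrite ler_norml => /andP[]; rewrite /preimage /=.
    by move: h; rewrite /preimage /=; lra.
  apply: le_measure; rewrite ?inE// => w /=.
  by have := coding_dist lam0 lam1 w n; rewrite ler_norml; lra.
- apply: (@le_trans _ _ (P [set w | pt (prefix w n) <= c + e / 2])).
    apply: le_measure; rewrite ?inE// => w /=.
    by have := coding_dist lam0 lam1 w n; rewrite ler_norml; lra.
  rewrite /F -(invariant_iter inv n (mle (c + e))) -H; apply: le_full => //.
  move=> p [/= h /near_pt]; rewrite ler_norml => /andP[]; rewrite /preimage /=.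
  by move: h; rewrite /preimage /=; lra.
Qed.


Lemma second_marginal (B : set R) : measurable B -> mu (snd @^-1` B) = P (coding @^-1` B).
Proof.
have FG c : F c = G c.
  apply/eqP; rewrite eq_le; apply/andP; split.
    apply: measure_right_continuous => [q|e e0]; first exact: mcle.
    by case: (law_compare c e0).
  apply: measure_right_continuous => [q|e e0]; first exact: mle.
  by case: (law_compare c e0).
pose m1 : {measure set R -> \bar R} := pushforward mu snd.
pose m2 : {measure set R -> \bar R} := pushforward P coding.
have msnd : measurable_fun [set: Om] snd by exact: measurable_snd.
move=> mB.
apply: (@measure_unique _ R R (@RGenOInfty.G R) (fun n => `]- n%:R, +oo[%classic) _ _ _ _ (m1 msnd) (m2 mcoding)) => //.
- exact: (@RGenOInfty.measurableE R).
- move=> _ _ [x ->] [y ->]; exists (Num.max x y); apply/seteqP; split => z /=.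
    by rewrite !in_itv /= !andbT gt_max => -[-> ->].
  by rewrite !in_itv /= !andbT gt_max => /andP[].
- by move=> n; exists (- n%:R).
- apply/seteqP; split => // x _; exists (Num.truncn `|x|).+1 => //=.
  rewrite in_itv /= andbT ltrNl; apply: le_lt_trans (truncnS_gt _).
  by rewrite -normrN ler_norm.
- move=> _ [c ->]; rewrite /m1 /m2 /= /pushforward.
  have -> : snd @^-1` `]c, +oo[ = ~` [set p : Om | p.2 <= c].
    by apply/seteqP; split => p; rewrite /preimage /= in_itv /= andbT ltNge => /negP.
  have -> : coding @^-1` `]c, +oo[ = ~` [set w : Sigma2 | coding w <= c].
    by apply/seteqP; split => p; rewrite /preimage /= in_itv /= andbT ltNge => /negP.
  have h1 := probability_setC mu (mle c); have h2 := probability_setC P (mcle c).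
  apply: (etrans h1); apply: etrans (esym h2); congr (_ - _)%E; exact: FG.
- move=> n; rewrite /m1 /= /pushforward; apply: le_lt_trans (ltry 1).
  by apply: probability_le1; rewrite -[_ @^-1` _]setTI; apply: msnd.
Qed.

Lemma second_marginal_integral (f : R -> R) : measurable_fun setT f -> (forall x, 0 <= f x) ->
  (\int[mu]_p (f p.2)%:E = \int[P]_w (f (coding w))%:E)%E.
Proof.
move=> mf f0.
have mfE : measurable_fun setT (EFin \o f) by exact/measurable_EFinP.
have msnd : measurable_fun [set: Om] snd by exact: measurable_snd.
have h1 := @ge0_integral_pushforward _ _ _ _ R _ msnd mu setT (EFin \o f) measurableT mfE.
have h2 := @ge0_integral_pushforward _ _ _ _ R _ mcoding P setT (EFin \o f) measurableT mfE.
apply: (etrans (esym (h1 _))); first by move=> x _; rewrite lee_fin.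
apply: (etrans _ (h2 _)); last by move=> x _; rewrite lee_fin.
pose m2 : {measure set R -> \bar R} := pushforward P coding.
pose m1 : {measure set R -> \bar R} := pushforward mu snd.
apply: (@eq_measure_integral _ _ _ setT (m2 mcoding) (m1 msnd)) => B mB _.
exact: second_marginal.
Qed.

End SecondMarginal.

Lemma b_nE n (p : Om) : b_n lam n p = beta_n lam n (iter n Phi p).2.
Proof.
rewrite iter_Phi /=; set X := compS_rev _ _ _.
transitivity #|[pred z : n.-tuple bool | `[< (compS lam (rev z) @` Ilam lam) X >]]|.
  have e (z : n.-tuple bool) : compS_rev lam z = compS lam (rev z).
    by apply/funext => x; exact: compS_revE.
  by apply: eq_card => z; rewrite !inE -e; apply/idP/idP => [/asboolP|h]; last apply/asboolP.
transitivity #|[pred z : n.-tuple bool | `[< (compS lam z @` Ilam lam) X >]]|; last first.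
  by apply: eq_card => z; rewrite !inE; apply/idP/idP => [h|/asboolP//]; apply/asboolP.
rewrite -!sum1_card [RHS](reindex_inj (h := fun z : n.-tuple bool => [tuple of rev z])) /=.
  by apply: eq_bigl => z; rewrite !inE.
by move=> x y /(congr1 val) /= /(can_inj revK) /val_inj.
Qed.

Lemma measurable_beta_fun n (g : nat -> R) : measurable_fun setT (fun x : R => g (beta_n lam n x)).
Proof.
pose Z (z : n.-tuple bool) (x : R) : bool := `|x - pt z| <= lam ^+ n * ell.
have -> : (fun x : R => g (beta_n lam n x)) =
   (fun s : {ffun n.-tuple bool -> bool} => g #|[pred z | s z]|) \o
   (fun x => [ffun z => Z z x]).
  apply/funext => x; rewrite /= beta_nE//; congr g.
  by apply: eq_card => z; rewrite !inE ffunE.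
apply: measurable_finite_fun; apply: measurable_ffun => z b.
have mZ : measurable_fun setT (Z z).
  apply: measurable_fun_ler; last exact: measurable_cst.
  by apply: measurableT_comp => //; apply: measurable_funB; [exact: measurable_id|exact: measurable_cst].
by rewrite -[_ @^-1` _]setTI; exact: mZ.
Qed.

Lemma measurable_ln_beta n : measurable_fun setT (fun x : R => ln (beta_n lam n x)%:R : R).
Proof. exact: (measurable_beta_fun n (fun k => ln k%:R)). Qed.

Lemma mme_overlap_integral (mu : probability Om R) : is_mme lam mu -> forall n,
  Rintegral mu setT (fun p => ln (b_n lam n p)%:R) =
  Rintegral P setT (fun w => ln (beta_n lam n (coding w))%:R).
Proof.
move=> [inv full mx] n; have [nu [inv' full' marg']] := lifted_measure.
have ks := le_trans (ks_entropy_ge marg') (mx nu inv' full').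
have marg := full_entropy_marginal lam0 inv ks.
rewrite /Rintegral; congr fine.
rewrite -(second_marginal_integral inv full marg (measurable_ln_beta n) (fun x => ln_nat_ge0 R (beta_n lam n x))).
rewrite -(invariant_integral inv n).
- by apply: eq_integral => p _; rewrite b_nE.
- by apply: (measurableT_comp (measurable_ln_beta n)); exact: measurable_snd.
- by move=> p; exact: ln_nat_ge0.
Qed.
End BernoulliLift.

(** * Growth of the overlap counts *)

Section OverlapGrowth.
Variables (R : realType) (lam : R).
Hypotheses (lam0 : 0 < lam) (lam1 : lam < 1).
Local Notation ell := (ell lam).
Local Notation pt := (pt lam).
Local Notation coding := (coding lam).
Variable P : probability Sigma2 R.
Hypothesis hP : is_uniform_bernoulli P.

Definition ln_beta n (w : Sigma2) : R := ln (beta_n lam n (coding w))%:R.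

Definition mean_ln_beta n : R := Rintegral P setT (ln_beta n).

Lemma measurable_ln_beta_coding n : measurable_fun setT (ln_beta n).
Proof.
apply: (measurableT_comp (measurable_ln_beta lam0 n)).
exact: measurable_coding.
Qed.

Lemma beta_sandwich n (w : Sigma2) :
  (min_rank lam (prefix_tuple w n) <= beta_n lam n (coding w) <= near_count lam (prefix_tuple w n))%N.
Proof.
rewrite (_ : coding w = compS lam (prefix_tuple w n) (coding (iter n shift w))); last first.
  exact: coding_prefix.
by rewrite beta_n_ge ?beta_n_le// coding_bound.
Qed.

Lemma ln_beta_sandwich n (w : Sigma2) :
  ln (min_rank lam (prefix_tuple w n))%:R <= ln_beta n w <= ln (near_count lam (prefix_tuple w n))%:R.
Proof.
have /andP[h1 h2] := beta_sandwich n w.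
have m0 := min_rank_gt0 lam (prefix_tuple w n).
have b0 := leq_trans m0 h1; have n0 := leq_trans b0 h2.
by rewrite /ln_beta !ler_ln ?posrE ?ltr0n// !ler_nat h1 h2.
Qed.

(** The first conjunct records that the integral is finite, so that [Rintegral] is not a default
    value. *)
Lemma mean_ln_betaE n : (\int[P]_w (ln_beta n w)%:E = (mean_ln_beta n)%:E)%E /\
  gavg lam n - 2 <= mean_ln_beta n <= gavg lam n + ln 5.
Proof.
have mb : measurable_fun setT (fun w => (ln_beta n w)%:E : \bar R).
  by apply/measurable_EFinP; exact: measurable_ln_beta_coding.
have hu : (\int[P]_w (ln_beta n w)%:E <= ((2 ^+ n)^-1 * \sum_(z : n.-tuple bool) ln (near_count lam z)%:R)%:E)%E.
  rewrite -(prefix_integral_bernoulli hP) => [|z]; last exact: ln_nat_ge0.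
  apply: ge0_le_integral => //.
  - by move=> w _; rewrite lee_fin ln_nat_ge0.
  - apply/measurable_EFinP.
    exact: (measurable_finite_fun (@measurable_prefix_tuple n) (fun z => ln (near_count lam z)%:R)).
  - by move=> w _; rewrite lee_fin; case/andP: (ln_beta_sandwich n w).
have hl : (((2 ^+ n)^-1 * \sum_(z : n.-tuple bool) ln (min_rank lam z)%:R)%:E <= \int[P]_w (ln_beta n w)%:E)%E.
  rewrite -(prefix_integral_bernoulli hP) => [|z]; last exact: ln_nat_ge0.
  apply: ge0_le_integral => //.
  - by move=> w _; rewrite lee_fin ln_nat_ge0.
  - apply/measurable_EFinP.
    exact: (measurable_finite_fun (@measurable_prefix_tuple n) (fun z => ln (min_rank lam z)%:R)).
  - by move=> w _; rewrite lee_fin; case/andP: (ln_beta_sandwich n w).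
have fin : (\int[P]_w (ln_beta n w)%:E)%E \is a fin_num.
  rewrite ge0_fin_numE; first exact: le_lt_trans hu (ltry _).
  by apply: integral_ge0 => w _; rewrite lee_fin ln_nat_ge0.
have E : (\int[P]_w (ln_beta n w)%:E = (mean_ln_beta n)%:E)%E by rewrite /mean_ln_beta /Rintegral fineK.
split=> //; rewrite E !lee_fin in hu hl.
rewrite (le_trans (avg_min_rank lam n) hl) /=.
exact: le_trans hu (avg_near_count lam n).
Qed.

Lemma mean_ln_beta_ge0 n : 0 <= mean_ln_beta n.
Proof. by apply: Rintegral_ge0 => w _; exact: ln_nat_ge0. Qed.

Lemma mean_ln_beta_cvg : cvg ((fun n => (n%:R)^-1 * mean_ln_beta n) @ \oo).
Proof.
have l5 : 0 <= ln 5 :> R by rewrite ln_ge0// ler1n.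
have l21 : 0 <= ln 21 :> R by rewrite ln_ge0// ler1n.
(* Passing to [gavg] costs [ln 5] once on the left and 2 for each of the two terms on the right;
   splitting words costs [ln 21]. *)
apply: (@quasi_subadditive_cvg _ _ (ln 5 + ln 21 + 4)).
- by rewrite !addr_ge0.
- exact: mean_ln_beta_ge0.
- move=> n m; have [_ /andP[n1 n2]] := mean_ln_betaE n.
  have [_ /andP[m1 m2]] := mean_ln_betaE m; have [_ /andP[k1 k2]] := mean_ln_betaE (n + m)%N.
  by have := gavgD lam0 lam1 n m; lra.
Qed.

Definition growth : R := lim ((fun n => (n%:R)^-1 * mean_ln_beta n) @ \oo).

Lemma ln_beta_le n (w : Sigma2) : ln_beta n w <= n%:R * ln 2.
Proof.
rewrite /ln_beta mulr_natl -lnXn//.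
case e : (beta_n lam n (coding w)) => [|k].
  by rewrite ln0// ln_ge0// exprn_ege1// ler1n.
rewrite ler_ln ?posrE ?exprn_gt0// -e -natrX ler_nat beta_nE//.
by rewrite (leq_trans (max_card _))// card_tuple card_bool.
Qed.

Lemma growth_le : growth <= ln 2.
Proof.
apply: (@limr_le _ _ _ _ _ (fun n => (n%:R)^-1 * mean_ln_beta n)); first exact: mean_ln_beta_cvg.
near=> n; have n0 : (0 < n)%N by near: n; exact: nbhs_infty_gt.
rewrite mulrC ler_pdivrMr ?ltr0n// mulrC -lee_fin -(mean_ln_betaE n).1.
rewrite -[leRHS]mule1 -(probability_setT P) -integral_cst//.
apply: ge0_le_integral => //.
- by move=> w _; rewrite lee_fin ln_nat_ge0.
- by apply/measurable_EFinP; exact: measurable_ln_beta_coding.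
- by move=> w _; rewrite lee_fin ln_beta_le.
Unshelve. all: by end_near. Qed.

Definition heavy (e : R) n : set Sigma2 := [set w | n%:R * (growth - e) <= ln_beta n w].

Lemma measurable_heavy e n : measurable (heavy e n).
Proof.
rewrite (_ : heavy e n = ln_beta n @^-1` `[n%:R * (growth - e), +oo[).
  by rewrite -[_ @^-1` _]setTI; exact: measurable_ln_beta_coding.
by apply/seteqP; split => w; rewrite /heavy /preimage /= in_itv /= andbT.
Qed.

Lemma measurable_lim_sup_heavy e : measurable (lim_sup_set (heavy e)).
Proof.
apply: bigcap_measurable => // n _; apply: bigcup_measurable => k _.
exact: measurable_heavy.
Qed.

(** If the upper limit were null, the probability of [heavy e n] would tend to 0, and since
    [ln_beta n] never exceeds [n ln 2], its mean would stay below [n (growth - e / 3)] for large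
    [n]. *)
Lemma lim_sup_heavy_pos (e : R) : 0 < e -> P (lim_sup_set (heavy e)) <> 0%E.
Proof.
move=> e0 h; case: (leP (growth - e) 0) => ge.
  have : P (lim_sup_set (heavy e)) = 1%E.
    rewrite (_ : lim_sup_set _ = setT) ?probability_setT//.
    apply/seteqP; split => // w _ n _; exists n => //=; rewrite /heavy /=.
    by apply: le_trans (ln_nat_ge0 _ _); rewrite mulr_ge0_le0.
  by rewrite h => /eqP; rewrite eq_sym onee_eq0.
have l20 : 0 < ln 2 :> R by rewrite ln_gt0// ltr1n.
(* With this probability, a heavy part on which the integrand is at most [n ln 2] contributes at
   most a third of the deficit [n e]. *)
have d0 : 0 < e / 3 / ln 2 by rewrite !divr_gt0.
have : P (\bigcup_(j >= n) heavy e j) @[n --> \oo] --> 0%E.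
  rewrite -h; apply: lim_sup_set_cvg; first exact: measurable_heavy.
  apply: le_lt_trans (ltry 1); apply: probability_le1.
  by apply: bigcup_measurable => k _; exact: measurable_heavy.
move=> /fine_cvgP[_] /cvgrPdist_le/(_ _ d0) hU.
have e30 : 0 < e / 3 by rewrite divr_gt0.
have /cvgrPdist_le/(_ _ e30) hL := mean_ln_beta_cvg.
suff : False by [].
near \oo => n.
have n0 : (0 < n)%N by near: n; exact: nbhs_infty_gt.
have nR : 0 < n%:R :> R by rewrite ltr0n.
have hn1 : `|growth - n%:R^-1 * mean_ln_beta n| <= e / 3 by near: n; exact: hL.
have hn2 : `|0 - fine (P (\bigcup_(j >= n) heavy e j))| <= e / 3 / ln 2 by near: n; exact: hU.
rewrite sub0r normrN in hn2.
pose U := \bigcup_(j >= n) heavy e j.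
have mU : measurable U by apply: bigcup_measurable => k _; exact: measurable_heavy.
have PU : (P (heavy e n) <= (e / 3 / ln 2)%:E)%E.
  apply: (@le_trans _ _ (P U)).
    by apply: le_measure; rewrite ?inE//; [exact: measurable_heavy|move=> w hw; exists n => /=].
  rewrite -[leLHS]fineK ?fin_num_measure// lee_fin.
  by apply: le_trans hn2; rewrite ler_norm.
have : (\int[P]_w (ln_beta n w)%:E <= (n%:R * (growth - e))%:E + (n%:R * ln 2)%:E * P (heavy e n))%E.
  pose g w := ((n%:R * (growth - e))%:E + (n%:R * ln 2)%:E * (\1_(heavy e n) w)%:E)%E : \bar R.
  have mi : measurable_fun setT (fun w => (\1_(heavy e n) w)%:E : \bar R).
    by apply/measurable_EFinP; apply: measurable_indic; exact: measurable_heavy.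
  have c1 : 0 <= n%:R * (growth - e) by rewrite mulr_ge0// ltW.
  have c2 : 0 <= n%:R * ln 2 :> R by rewrite mulr_ge0// ltW.
  have -> : ((n%:R * (growth - e))%:E + (n%:R * ln 2)%:E * P (heavy e n))%E = (\int[P]_w g w)%E.
    rewrite /g ge0_integralD//; last 2 first.
    - by move=> w _; rewrite mule_ge0 ?lee_fin.
    - exact: measurable_funeM.
    rewrite integral_cst// [X in (_ * X + _)%E](probability_setT P) mule1.
    rewrite ge0_integralZl//.
    by rewrite integral_indic ?setIT//; exact: measurable_heavy.
  apply: ge0_le_integral => //.
  - by move=> w _; rewrite lee_fin ln_nat_ge0.
  - by apply/measurable_EFinP; exact: measurable_ln_beta_coding.
  - by apply: emeasurable_funD; [exact: measurable_cst|exact: measurable_funeM].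
  - move=> w _; rewrite /g -EFinM -EFinD lee_fin indicE.
    case: (pselect (heavy e n w)) => hw.
      by rewrite mem_set// mulr1 (le_trans (ln_beta_le _ _))// lerDr.
    by rewrite memNset// mulr0 addr0 ltW// ltNge; apply/negP.
rewrite (mean_ln_betaE n).1 => hI.
have : (mean_ln_beta n <= n%:R * (growth - e) + n%:R * ln 2 * (e / 3 / ln 2)).
  rewrite -lee_fin EFinD [X in (_ + X)%E]EFinM; apply: (le_trans hI); apply: leeD => //.
  by apply: lee_pmul => //; rewrite lee_fin mulr_ge0// ltW.
have -> : n%:R * ln 2 * (e / 3 / ln 2) = n%:R * (e / 3) by field; rewrite gt_eqF.
move: hn1; rewrite ler_norml => /andP[_].
rewrite lerBlDr -lerBlDl [_^-1 * _]mulrC ler_pdivlMr// => k1 k2.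
have := le_trans k1 k2; rewrite -mulrDr [_ * n%:R]mulrC ler_pM2l//; lra.
Unshelve. all: by end_near. Qed.

(** Prepending the first [k] letters of [w] is injective and, by self-similarity, turns words
    covering the shifted point into words covering the original one. *)
Lemma beta_shift n k (w : Sigma2) :
  (beta_n lam n (coding (iter k shift w)) <= beta_n lam (k + n) (coding w))%N.
Proof.
pose J (z : n.-tuple bool) : (k + n).-tuple bool := [tuple of prefix_tuple w k ++ z].
have Jinj : injective J.
  move=> x y /(congr1 val) /= /eqP; rewrite eqseq_cat// => /andP[_ /eqP h].
  exact: val_inj.
rewrite !beta_nE// -(fintype.card_image Jinj); apply: subset_leq_card.
apply/fintype.subsetP => z /fintype.imageP[x]; rewrite !inE => hx ->.
rewrite (coding_prefix lam0 lam1 w k) compSE /J /= pt_cat size_prefix_word.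
rewrite opprD addrACA subrr add0r -mulrBr normrM gtr0_norm ?exprn_gt0// exprD -mulrA.
by rewrite ler_pM2l// exprn_gt0.
Qed.

(** The zero-one law needs a set containing its shift preimage, such as the union [V] of all
    iterated preimages of the upper limit for [e / 2]. Returning from the [k]-fold shift to [w]
    lengthens words by [k], which the spare [e / 2] absorbs for large [n]; so [V] lies in the upper
    limit for [e]. *)
Lemma lim_sup_heavy_full (e : R) : 0 < e -> P (lim_sup_set (heavy e)) = 1%E.
Proof.
move=> e0; have e20 : 0 < e / 2 by rewrite divr_gt0.
pose E := lim_sup_set (heavy (e / 2)).
have mE : measurable E := measurable_lim_sup_heavy _.
pose V := \bigcup_k (iter k shift @^-1` E).
have mV : measurable V.
  apply: bigcupT_measurable => k; rewrite -[_ @^-1` _]setTI; exact: measurable_iter_shift.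
have sV : shift @^-1` V `<=` V.
  by move=> w [k _ h]; exists k.+1 => //; rewrite /preimage /= -iterS iterSr.
have EV : E `<=` V by move=> w h; exists 0%N.
have VF : V `<=` lim_sup_set (heavy e).
  move=> w [k _ Ew] N _.
  pose M := (Num.truncn (k%:R * `|growth - e| / (e / 2))).+1.
  have [n /= nN hn] := Ew (N + M)%N I.
  exists (k + n)%N => /=; first by rewrite (leq_trans _ (leq_addl _ _))// (leq_trans (leq_addr M N)).
  rewrite /heavy /=; rewrite /heavy /= in hn.
  have b0 : (0 < beta_n lam n (coding (iter k shift w)))%N.
    have /andP[h _] := beta_sandwich n (iter k shift w).
    exact: leq_trans (min_rank_gt0 _ _) h.
  apply: (@le_trans _ _ (ln_beta n (iter k shift w))); last first.
    have b1 := beta_shift n k w.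
    by rewrite /ln_beta ler_ln ?posrE ?ltr0n ?ler_nat// (leq_trans b0).
  apply: le_trans hn.
  have hM : k%:R * `|growth - e| <= n%:R * (e / 2).
    rewrite -ler_pdivrMr//; apply: (le_trans (ltW (truncnS_gt _))).
    by rewrite -/M ler_nat (leq_trans _ nN)// leq_addl.
  have h1 : k%:R * (growth - e) <= k%:R * `|growth - e| by rewrite ler_wpM2l// ler_norm.
  rewrite natrD mulrDl.
  have -> : n%:R * (growth - e / 2) = n%:R * (growth - e) + n%:R * (e / 2) by field.
  by lra.
have : P V = 1%E.
  case: (bernoulli_zero_one hP mV sV) => // PV0; exfalso.
  apply: (lim_sup_heavy_pos e20); apply/eqP; rewrite eq_le measure_ge0 andbT -PV0.
  by apply: le_measure; rewrite ?inE.
move=> PV; apply/eqP; rewrite eq_le probability_le1 /=; last exact: measurable_lim_sup_heavy.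
rewrite -PV; apply: le_measure; rewrite ?inE//; exact: measurable_lim_sup_heavy.
Qed.

End OverlapGrowth.

(** * Hausdorff dimension *)

Section DyadicEnumeration.
Variable R : realType.

Lemma dyadic_level n k : (k < 2 ^ n)%N -> trunc_log 2 (2 ^ n + k) = n.
Proof. by move=> kn; apply: trunc_log_eq => //; rewrite leq_addr expnS; lia. Qed.

(** Covers in [hausdorff_delta] are sequences of sets, so a family indexed by the words of all
    lengths has to be listed. The default word is returned only for [k >= 2 ^ n], which the
    enumeration never asks for. *)
Definition dyadic_word (n k : nat) : n.-tuple bool :=
  nth [tuple of nseq n false] (enum {: n.-tuple bool}) k.

(* Index [2 ^ n + k - 1] carries the [k]-th word of length [n]. *)
Definition dyadic (U : Type) (f : forall n, n.-tuple bool -> U) (i : nat) : U :=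
  let n := trunc_log 2 i.+1 in f n (dyadic_word n (i.+1 - 2 ^ n)).

Lemma dyadic_index (U : Type) (f : forall n, n.-tuple bool -> U) n z :
  exists i, dyadic f i = f n z.
Proof.
pose k := index z (enum {: n.-tuple bool}).
have kn : (k < 2 ^ n)%N.
  by rewrite -card_bool -card_tuple cardE index_mem mem_enum.
exists (2 ^ n + k).-1; have p : (0 < 2 ^ n + k)%N by rewrite addn_gt0 expn_gt0.
rewrite /dyadic prednK// dyadic_level// addKn; congr f.
by rewrite /dyadic_word nth_index// mem_enum.
Qed.

Lemma dyadic_sum (f : forall n, n.-tuple bool -> R) M :
  \sum_(0 <= i < (2 ^ M).-1) dyadic f i = \sum_(0 <= n < M) \sum_(z : n.-tuple bool) f n z.
Proof.
elim: M => [|M IH]; first by rewrite !big_geq.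
rewrite big_nat_recr//= -IH (big_cat_nat (n := (2 ^ M).-1))//=; last first.
  by rewrite -ltnS !prednK ?expn_gt0// leq_exp2l.
congr (_ + _).
have e : (2 ^ M.+1).-1 = (2 ^ M + (2 ^ M).-1)%N.
  by have := expn_gt0 2 M; rewrite expnS; lia.
rewrite e -{1}[(2 ^ M).-1]add0n big_addn addnK.
have -> : \sum_(z : M.-tuple bool) f M z = \sum_(z <- enum {: M.-tuple bool}) f M z.
  by rewrite big_enum /=; apply: eq_bigl.
rewrite (big_nth [tuple of nseq M false]) -cardE card_tuple card_bool.
apply: eq_big_nat => k /andP[_ kM]; rewrite /dyadic.
have -> : (k + (2 ^ M).-1).+1 = (2 ^ M + k)%N by have := expn_gt0 2 M; lia.
by rewrite dyadic_level// addKn.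
Qed.

Lemma dyadic_series_le (f : forall n, n.-tuple bool -> R) (B : R) :
  (forall n z, 0 <= f n z) ->
  (forall M, \sum_(0 <= n < M) \sum_(z : n.-tuple bool) f n z <= B) ->
  (\sum_(0 <= i <oo) (dyadic f i)%:E <= B%:E)%E.
Proof.
move=> f0 fB; apply: lime_le.
  by apply: is_cvg_nneseries => i _ _; rewrite lee_fin /dyadic.
apply: nearW => m; rewrite sumEFin lee_fin; apply: le_trans (fB m); rewrite -dyadic_sum.
have mM : (m <= (2 ^ m).-1)%N by rewrite -ltnS prednK ?expn_gt0// ltn_expl.
by rewrite [leRHS](big_cat_nat (n := m))//= lerDl sumr_ge0// => i _; rewrite /dyadic.
Qed.

End DyadicEnumeration.

(** * Covers by balls around crowded cells *)

Section Dimension.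
Variables (R : realType) (lam : R).
Hypotheses (lam0 : 0 < lam) (lam1 : lam < 1).
Local Notation ell := (ell lam).
Local Notation pt := (pt lam).
Local Notation wcell := (wcell lam).

(** The radius is twice that of a cylinder: a covered point is within one mesh of some [pt s], and
    the representative of the cell of [s] lies within another. *)
Definition block_ball n (z : n.-tuple bool) : set R :=
  [set x | `|x - pt z| <= 2 * (lam ^+ n * ell)].

Lemma hcost_block_ball (s : R) n (z : n.-tuple bool) : 0 <= s ->
  (hcost s (block_ball z) <= ((4 * (lam ^+ n * ell)) `^ s)%:E)%E /\
  (diamE (block_ball z) <= (4 * (lam ^+ n * ell))%:E)%E.
Proof.
move=> s0; have c0 := scale_gt0 lam0 lam1 n.
have dle : (diamE (block_ball z) <= (4 * (lam ^+ n * ell))%:E)%E.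
  apply: ge_ereal_sup => _ [x [y [+ [+ ->]]]]; rewrite /block_ball /= lee_fin !ler_norml; lra.
split=> //; rewrite /hcost; case: asboolP => _; first by rewrite lee_fin powR_ge0.
have d0 : (0 <= diamE (block_ball z))%E.
  apply: ereal_sup_ubound; exists (pt z), (pt z).
  by rewrite /block_ball /= !subrr normr0; split; [|split=> //]; rewrite mulr_ge0// ltW.
have fd : diamE (block_ball z) \is a fin_num.
  by rewrite ge0_fin_numE// (le_lt_trans dle)// ltry.
rewrite lee_fin ge0_ler_powR// ?nnegrE ?fine_ge0//; first by rewrite mulr_ge0// ltW.
by rewrite -lee_fin fineK.
Qed.

(** Two words covering the same point are at most two meshes apart, and replacing one of them by its
    cell representative adds a third; hence the 3. *)
Definition crowd n (z : n.-tuple bool) : nat :=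
  #|[pred s : n.-tuple bool | `|wcell s - wcell z| <= 3%N%:Z]|.

(** Selects one word per occupied cell, so that the cover uses one ball per cell instead of one per
    word. *)
Definition cell_rep n (z : n.-tuple bool) : bool := [pick s | wcell s == wcell z] == Some z.

(** Markov's inequality: summed over occupied cells, [crowd] counts each word at most
    [7 = 2 * 3 + 1] times. *)
Lemma count_crowded_cells n (b : R) : 0 < b ->
  \sum_(z : n.-tuple bool | cell_rep z && (b <= (crowd z)%:R)) 1 <= 7 * 2 ^+ n / b :> R.
Proof.
move=> b0; rewrite big_mkcond /= (sum_by_cells (@wcell n)) /=.
rewrite ler_pdivlMr// mulr_suml.
apply: le_trans (near_count_sum lam n 3); apply: ler_sum => s _.
rewrite sumr_const -[leRHS]mulr_natr -mulrA ler_wpM2l ?invr_ge0//.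
rewrite -[X in _ <= X%:R]/(crowd s).
have same (t : n.-tuple bool) : wcell t == wcell s -> crowd t = crowd s.
  by move=> /eqP e; rewrite /crowd; apply: eq_card => u; rewrite !inE e.
have one : \sum_(t : n.-tuple bool | wcell t == wcell s)
    (if cell_rep t && (b <= (crowd t)%:R) then 1 else 0) <= (nat_of_bool (b <= (crowd s)%:R)%R)%:R :> R.
  case: (boolP (b <= (crowd s)%:R)) => hb; last first.
    by rewrite big1 => [//|t ts]; rewrite (same _ ts) (negbTE hb) andbF.
  rewrite -big_mkcondr /= sumr_const ler_nat.
  apply/card_le1_eqP => t t'; rewrite !unfold_in => /and3P[/eqP ts /eqP rt _] /and3P[/eqP t's /eqP rt' _].
  by apply: Some_inj; rewrite -rt -rt' ts t's.
apply: (le_trans (ler_wpM2r (ltW b0) one)).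
by case: (boolP (b <= (crowd s)%:R)) => hb; rewrite ?mul1r ?mul0r.
Qed.

Lemma near_words_crowd n (x : R) : (0 < beta_n lam n x)%N ->
  exists z : n.-tuple bool,
    [/\ cell_rep z, block_ball z x & (beta_n lam n x <= crowd z)%N].
Proof.
rewrite beta_nE// => /card_gt0P[s]; rewrite inE => hs.
have : exists2 z : n.-tuple bool,
    [pick s' : n.-tuple bool | wcell s' == wcell s] = Some z & wcell z = wcell s.
  by case: pickP => [z /eqP e|/(_ s)]; [exists z|rewrite eqxx].
move=> [z hz zs]; exists z; have zs' := wcell_same lam0 lam1 zs; split.
- by rewrite /cell_rep zs hz.
- by move: hs zs'; rewrite /block_ball /= !ler_norml; lra.
- apply: subset_leq_card; apply/fintype.subsetP => s'; rewrite !inE => hs'.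
  apply: floor_near_scaled => //.
  by move: hs hs' zs'; rewrite !ler_norml; lra.
Qed.

(* [2 * expR (- b) * lam `^ s = expR (- e)], so the costs of the levels form a
   convergent geometric series. *)
Lemma hausdorff_heavy (b s e : R) : 0 < e -> 0 < s -> s * `|ln lam| = ln 2 - b + e ->
  hausdorff_measure s [set x | forall N, exists2 n, (N <= n)%N &
    n%:R * b <= ln (beta_n lam n x)%:R /\ (0 < beta_n lam n x)%N] = 0%E.
Proof.
move=> e0 s0 hs; set Z := [set x | _].
have c0 n := scale_gt0 lam0 lam1 n.
have hcost0 (t : R) (U : set R) : (0 <= hcost t U)%E.
  by rewrite /hcost; case: asboolP => // _; rewrite lee_fin powR_ge0.
suff h0 delta : 0 < delta -> hausdorff_delta s delta Z = 0%E.
  apply/eqP; rewrite eq_le; apply/andP; split.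
    by apply: ge_ereal_sup => _ [delta d0 ->]; rewrite h0.
  by apply: ereal_sup_ubound; exists 1 => //; rewrite h0.
move=> d0; apply/eqP; rewrite eq_le; apply/andP; split; last first.
  by apply: le_ereal_inf_tmp => _ [U [_ _ ->]]; apply: nneseries_ge0.
pose rho := expR (- e).
have rho0 : 0 < rho by exact: expR_gt0.
have rho1 : rho < 1 by rewrite expR_lt1 oppr_lt0.
(* The 7 comes from counting crowded cells, [4 * ell] from the diameter of a ball of radius two
   meshes. *)
pose C := 7 * (4 * ell) `^ s.
have el0 : 0 < 4 * ell by rewrite mulr_gt0// ell_gt0.
have C0 : 0 <= C by rewrite mulr_ge0// powR_ge0.
apply/lee_addgt0Pr => eta eta0; rewrite add0e.
have : exists N, (C * rho ^+ N / (1 - rho) <= eta) /\ 4 * (lam ^+ N * ell) <= delta.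
  have cr : (fun n => rho ^+ n) @ \oo --> (0 : R) by apply: cvg_expr; rewrite gtr0_norm.
  have t1 : 0 < eta * (1 - rho) / (C + 1).
    by rewrite divr_gt0 ?mulr_gt0 ?subr_gt0// ltr_wpDl.
  have t2 : 0 < delta / 4 by rewrite divr_gt0.
  have /cvgrPdist_le/(_ _ t1) [N1 _ h1] := cr.
  have [N2 _ h2] := geo_ell_small lam0 lam1 t2.
  exists (maxn N1 N2); split; last first.
    by have := h2 _ (leq_maxr N1 N2); rewrite /= ltr_pdivlMr// mulrC => /ltW.
  have := h1 _ (leq_maxl N1 N2); rewrite /= sub0r normrN gtr0_norm ?exprn_gt0//.
  rewrite ler_pdivlMr ?ltr_wpDl// => h.
  rewrite ler_pdivrMr ?subr_gt0// (le_trans _ h)// mulrC ler_wpM2l ?lerDl//.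
  by rewrite exprn_ge0// ltW.
move=> [N [hN hd]].
(* Unselected words receive the empty set, whose cost is 0 by the definition of [hcost]; levels
   below [N] are dropped to make diameters and total cost small. *)
pose sel n (z : n.-tuple bool) : bool :=
  [&& (N <= n)%N, cell_rep z & expR (n%:R * b) <= (crowd z)%:R].
pose V n (z : n.-tuple bool) : set R := if sel n z then block_ball z else set0.
pose f n (z : n.-tuple bool) : R := if sel n z then (4 * (lam ^+ n * ell)) `^ s else 0.
have f0 n z : 0 <= f n z by rewrite /f; case: ifP => // _; exact: powR_ge0.
have lamE : lam = expR (ln lam) by rewrite lnK.
have ln0 : ln lam < 0 by rewrite ln_lt0// lam0.
have fsum n : \sum_(z : n.-tuple bool) f n z <= if (N <= n)%N then C * rho ^+ n else 0.
  case: (leqP N n) => Nn; last first.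
    by rewrite big1// => z _; rewrite /f /sel leqNgt Nn.
  have := @count_crowded_cells n (expR (n%:R * b)) (expR_gt0 _).
  rewrite big_mkcond /= => h.
  have p0 : 0 <= (4 * (lam ^+ n * ell)) `^ s by exact: powR_ge0.
  have := ler_wpM2r p0 h; rewrite mulr_suml => {}h.
  apply: (le_trans (le_trans _ h)).
    apply: ler_sum => z _; rewrite /f /sel Nn /=.
    by case: ifP => _; rewrite ?mul1r ?mul0r.
  rewrite le_eqVlt; apply/orP; left; apply/eqP.
  have -> : 4 * (lam ^+ n * ell) = lam ^+ n * (4 * ell) by ring.
  rewrite powRM ?exprn_ge0 ?(ltW lam0) ?(ltW el0)//.
  have -> : (lam ^+ n) `^ s = expR (n%:R * (s * ln lam)).
    by rewrite /powR gt_eqF ?exprn_gt0// lnXn// -[ln lam *+ n]mulr_natl mulrCA.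
  rewrite /C /rho -expRM_natl -expRN.
  have -> : 2 ^+ n = expR (n%:R * ln 2) :> R by rewrite expRM_natl lnK ?posrE.
  have -> : n%:R * - e = n%:R * ln 2 - n%:R * b + n%:R * (s * ln lam).
    by move: hs; rewrite ltr0_norm// => hs'; have -> : s * ln lam = - (ln 2 - b + e) by [rewrite -hs'; ring]; ring.
  by rewrite !expRD; ring.
have dV n z : (hcost s (V n z) <= (f n z)%:E)%E /\ (diamE (V n z) <= delta%:E)%E.
  rewrite /V /f; case: ifP => [/and3P[Nn _ _]|_].
    have [h1 h2] := hcost_block_ball z (ltW s0); split=> //; apply: (le_trans h2).
    rewrite lee_fin; apply: le_trans hd; rewrite ler_pM2l// ler_pM2r ?ell_gt0//.
    by rewrite ler_wiXn2l// ltW.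
  split; first by rewrite /hcost; case: asboolP.
  by apply: ge_ereal_sup => e' [x [y [h _]]]; case: h.
apply: (@le_trans _ _ (\sum_(0 <= i <oo) hcost s (dyadic V i))%E).
  apply: ereal_inf_lbound; exists (dyadic V); split => //; last first.
    by move=> i; rewrite /dyadic; exact: (dV _ _).2.
  move=> x Zx; have [n Nn [hb b0]] := Zx N.
  have [z [rz bz cz]] := near_words_crowd b0; have [i iE] := dyadic_index V z.
  exists i => //; rewrite iE /V ifT// /sel Nn rz /=.
  apply: (@le_trans _ _ (beta_n lam n x)%:R); last by rewrite ler_nat.
  by rewrite -[leRHS]lnK ?posrE ?ltr0n// ler_expR.
apply: (@le_trans _ _ (\sum_(0 <= i <oo) (dyadic f i)%:E)%E).
  apply: lee_nneseries => [i _ _|i _]; first exact: hcost0.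
  by rewrite /dyadic; exact: (dV _ _).1.
apply: dyadic_series_le => // M; apply: le_trans hN; rewrite ler_pdivlMr ?subr_gt0//.
apply: (@le_trans _ _ ((\sum_(0 <= n < M) (if (N <= n)%N then C * rho ^+ n else 0)) * (1 - rho))).
  by rewrite ler_wpM2r ?subr_ge0 ?(ltW rho1)// ler_sum.
have rn n : 0 <= C * rho ^+ n by rewrite mulr_ge0// exprn_ge0// ltW.
(* The added term is the part of the geometric series not yet summed, times [1 - rho]; with it the
   inequality propagates by induction. *)
suff : (\sum_(0 <= n < M) (if (N <= n)%N then C * rho ^+ n else 0)) * (1 - rho) +
   (if (N <= M)%N then C * rho ^+ M else C * rho ^+ N) <= C * rho ^+ N.
  by apply: le_trans; rewrite lerDl; case: ifP.
elim: M => [|M IH]; first by rewrite big_geq// mul0r add0r; case: ifP => //; rewrite leqn0 => /eqP ->.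
rewrite big_nat_recr//=; move: IH; case: (ltngtP N M) => NM; rewrite ?(leqW (ltnW NM)).
- by rewrite mulrDl exprS => h; move: h; lra.
- rewrite addr0; case: ifP => // NM'; have -> : N = M.+1 by lia.
  by [].
- by rewrite NM leqnSn mulrDl exprS; lra.
Qed.

End Dimension.

Lemma hdim_ge0 (R : realType) (Z : set R) : 0 <= hdim Z.
Proof.
rewrite /hdim; set S := [set s | _].
(* The infimum of the empty set is the default 0. *)
have [->|/set0P S0] := eqVneq S set0; first by rewrite inf0.
by apply: lb_le_inf => // s [].
Qed.

Lemma hdim_le (R : realType) (Z : set R) (s : R) :
  0 <= s -> hausdorff_measure s Z = 0%E -> hdim Z <= s.
Proof. by move=> s0 h; apply: ge_inf; [exists 0 => ? []|split]. Qed.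

(** * The dimension bound *)

Section BernoulliDimension.
Variables (R : realType) (lam : R).
Hypotheses (lam0 : 0 < lam) (lam1 : lam < 1).
Variable P : probability Sigma2 R.
Hypothesis hP : is_uniform_bernoulli P.
Local Notation growth := (growth lam P).

Lemma hdim_bernoulli_le :
  hdim_measure (bernoulli_conv lam P) <= (ln 2 - growth) / `|ln lam|.
Proof.
have ln0 : 0 < `|ln lam| by rewrite normr_gt0 lt_eqF// ln_lt0// lam0.
apply/ler_addgt0Pr => eta eta0.
(* The slack [eta] is split in two: one [e] is lost in the growth rate [b], the other makes the
   costs of the levels decay geometrically. *)
pose e := eta * `|ln lam| / 2; have e0 : 0 < e by rewrite divr_gt0// mulr_gt0.
pose b := growth - e; pose s := (ln 2 - growth) / `|ln lam| + eta.
have s0 : 0 < s.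
  by rewrite /s ltr_wpDl// divr_ge0// ?subr_ge0 ?(growth_le lam0 lam1 hP)// ltW.
have hs : s * `|ln lam| = ln 2 - b + e.
  by rewrite /s /b /e; field; rewrite gt_eqF.
(* As [ln 0 = 0], the first clause alone would admit points covered by no word when [b <= 0]. *)
pose D n : set R := [set x | n%:R * b <= ln (beta_n lam n x)%:R /\ (0 < beta_n lam n x)%N].
pose Z : set R := [set x | forall N, exists2 n, (N <= n)%N & D n x].
have mD n : measurable (D n).
  have -> : D n = ((fun x : R => ln (beta_n lam n x)%:R : R) @^-1` `[n%:R * b, +oo[%classic) `&`
      ((fun x : R => (beta_n lam n x)%:R : R) @^-1` `]0, +oo[%classic).
    by apply/seteqP; split => x; rewrite /D /preimage /= !in_itv /= !andbT ltr0n.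
  apply: measurableI; rewrite -[_ @^-1` _]setTI.
    by apply: (measurable_beta_fun lam0 n (fun k => ln k%:R)) => //; exact: measurable_itv.
  by apply: (measurable_beta_fun lam0 n (fun k => k%:R)) => //; exact: measurable_itv.
have ZE : Z = lim_sup_set D.
  apply/seteqP; split => x h N.
    by move=> _; have [n Nn Dn] := h N; exists n.
  by have [n Nn Dn] := h N I; exists n.
have mZ : measurable Z.
  by rewrite ZE; apply: bigcap_measurable => // n _; exact: bigcup_measurable.
apply: (@le_trans _ _ (hdim Z)); last first.
  apply: hdim_le; first exact: ltW.
  exact: (hausdorff_heavy lam0 lam1 e0 s0 hs).
apply: ge_inf; first by exists 0 => _ [? [_ _ ->]]; exact: hdim_ge0.
exists Z; split => //; rewrite /bernoulli_conv /pushforward.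
have mlim := measurable_lim_sup_heavy lam0 lam1 P e.
apply/eqP; rewrite eq_le measure_ge0 andbT.
have <- : P (~` lim_sup_set (heavy lam P e)) = 0%E.
  by rewrite probability_setC// (lim_sup_heavy_full lam0 lam1 hP e0) subee.
apply: le_measure; rewrite ?inE; last first.
- move=> w; rewrite /preimage /=; apply: contra_not => h N.
  have [n Nn hn] := h N I; exists n => //; split=> //.
  by have /andP[h' _] := beta_sandwich lam0 lam1 n w; exact: leq_trans (min_rank_gt0 _ _) h'.
- exact: measurableC.
rewrite -[_ @^-1` _]setTI; apply: (measurable_coding lam0 lam1) => //; exact: measurableC.
Qed.

End BernoulliDimension.

Theorem theorem3p1 (R : realType) (lam : R) (hlam : 2^-1 < lam < 1)
  (P : probability Sigma2 R) (hP : is_uniform_bernoulli P)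
  (mu : probability (Sigma2 * R)%type R) (hmu : is_mme lam mu) :
  let nu := bernoulli_conv lam P in
  let o := overlap lam mu in
  let bseq := fun n : nat => (n%:R)^-1 *
                Rintegral mu setT (fun p => ln ((b_n lam n p)%:R : R)) in
  let betaseq := fun n : nat => (n%:R)^-1 *
                Rintegral P setT (fun w => ln ((beta_n lam n (coding lam w))%:R : R)) in
  [/\ hdim_measure nu <= ln (2 / o) / `|ln lam|,
      cvg (bseq @ \oo),
      cvg (betaseq @ \oo),
      o = expR (lim (betaseq @ \oo)) &
      o <= 2 * lam `^ (hdim_measure nu)].
Proof.
move=> nu o bseq betaseq.
have lam1 : lam < 1 by case/andP: hlam.
have lam0 : 0 < lam by case/andP: hlam => h _; apply: lt_trans h; rewrite invr_gt0.
have bE : bseq = betaseq.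
  by apply/funext => n; rewrite /bseq (mme_overlap_integral lam0 lam1 hP hmu).
have cb : cvg (betaseq @ \oo) := mean_ln_beta_cvg lam0 lam1 hP.
have oE : o = expR (lim (betaseq @ \oo)) by rewrite -bE.
have ln0 : 0 < `|ln lam| by rewrite normr_gt0 lt_eqF// ln_lt0// lam0.
have hd : hdim_measure nu <= ln (2 / o) / `|ln lam|.
  by rewrite ln_div ?posrE ?oE ?expR_gt0// expRK; exact: hdim_bernoulli_le.
split => //; first by rewrite bE.
(* The last inequality is the dimension bound multiplied by [|ln lam|] and exponentiated. *)
move: hd; rewrite ler_pdivlMr// ltr0_norm ?ln_lt0 ?lam0// ln_div ?posrE ?oE ?expR_gt0// expRK => hd.
rewrite /powR gt_eqF// -[X in _ <= X * _]lnK ?posrE// -expRD ler_expR.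
by move: hd; lra.
Qed.
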